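(* Let $P,Q$ be orthogonal projections on a separable Hilbert space $\mathcal{H}$, and let $X$ be the operator of the Halmos decomposition of the pair $P,Q$. Then the following are equivalent: (1) $PQ$ is Schmidt decomposable. (2) $[P,Q]=PQ-QP$ is diagonalizable. (3) $X$ is diagonalizable. Moreover, if $PQ$ has singular values $s_n$, $n\ge1$, then $[P,Q]$ has eigenvalues $\pm i\,s_n\sqrt{1-s_n^2}$, $n\ge1$, and possibly also $0$.
   Context: An operator is diagonalizable if there is an orthonormal basis of the space consisting of its eigenvectors. A bounded operator $T$ is Schmidt decomposable if it has a singular value decomposition: there exist (finite or countable) orthonormal systems $\{f_n\}_{n\ge1}$, $\{g_n\}_{n\ge1}$ and positive numbers $s_n$ (the singular values of $T$) such that $T=\sum_{n\ge1}s_n\,f_n\otimes g_n$ (strong convergence), where $(f\otimes g)(h)=\langle h,g\rangle f$. Halmos decomposition: given orthogonal projections $P,Q$, put $\mathcal{H}_{11}=R(P)\cap R(Q)$, $\mathcal{H}_{00}=N(P)\cap N(Q)$, $\mathcal{H}_{10}=R(P)\cap N(Q)$, $\mathcal{H}_{01}=N(P)\cap R(Q)$, and let the generic part be $\mathcal{H}'=(\mathcal{H}_{11}\oplus\mathcal{H}_{00}\oplus\mathcal{H}_{10}\oplus\mathcal{H}_{01})^\perp$ ($R$ denotes range and $N$ nullspace). These five subspaces reduce $P$ and $Q$. By a theorem of Halmos there are a Hilbert space $\mathcal{L}$ and a unitary isomorphism $\mathcal{H}'\simeq\mathcal{L}\times\mathcal{L}$ under which the reductions of $P$ and $Q$ to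 $\mathcal{H}'$ become $$P'=\begin{pmatrix}1&0\\0&0\end{pmatrix},\qquad Q'=\begin{pmatrix}C^2&CS\\ CS&S^2\end{pmatrix},$$ where $C=\cos(X)\ge0$, $S=\sin(X)\ge0$ for a selfadjoint operator $X$ on $\mathcal{L}$ with $0\le X\le\pi/2$, and $C,S,X$ have trivial nullspaces. *)

(* Defs.v *)
From HB Require Import structures.
From mathcomp Require Import all_boot all_order all_algebra.
From mathcomp Require Import complex.
From mathcomp Require Import all_classical all_reals all_analysis.

Set Implicit Arguments.
Unset Strict Implicit.
Unset Printing Implicit Defensive.

Import Order.TTheory GRing.Theory Num.Theory.
Import numFieldNormedType.Exports.

Local Open Scope classical_set_scope.
Local Open Scope ring_scope.
Local Open Scope complex_scope.

(* The inner product is linear in its first argument and conjugate-linear in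
   the second one. *)
HB.mixin Record isHilbert (R : realType) H of CompleteNormedModule R[i] H := {
  hdot : {dot H for (@Num.conj R[i])} ;
  hdot_norm : forall x : H, `|x| ^+ 2 = hdot x x
}.

#[short(type="hilbertType")]
HB.structure Definition Hilbert (R : realType) :=
  { H of CompleteNormedModule R[i] H & isHilbert R H }.

Notation "''<' x , y >" := (hdot x y)
  (at level 2, x at level 69, y at level 69, format "''<' x ,  y >") : ring_scope.

Section Hilbert_defs.
Variables (R : realType) (H : hilbertType R).
Implicit Types (A B : set H) (T P Q : H -> H).

Definition separable_space : Prop :=
  exists A : set H, countable A /\ dense A.

Definition orthonormal_system (I : eqType) (D : set I) (e : I -> H) : Prop :=
  forall m n, D m -> D n -> '<e m, e n> = (m == n)%:R.

Definition lin_span A : set H :=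
  [set x | exists n (a : 'I_n -> R[i]) (b : 'I_n -> H),
     (forall i, A (b i)) /\ x = \sum_(i < n) a i *: b i].

Definition orthonormal_basis B : Prop :=
  orthonormal_system B idfun /\ closure (lin_span B) = setT.

Definition eigenval T (l : R[i]) : Prop := exists2 v, v != 0 & T v = l *: v.

Definition diagonalizable_op T : Prop :=
  exists B, orthonormal_basis B /\ forall e, B e -> exists l : R[i], T e = l *: e.

Definition rank_one (f g : H) : H -> H := fun h => '<h, g> *: f.

(* The index set [D] is an arbitrary subset of [nat], so that the systems are
   finite (possibly empty) or countably infinite; the partial sums are taken in
   the order of [nat]. *)
Definition schmidt_decomposition T (D : set nat) (s : nat -> R)
    (f g : nat -> H) : Prop :=
  [/\ forall n, D n -> 0 < s n,
      orthonormal_system D f,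
      orthonormal_system D g &
      forall h : H,
        (fun k => \sum_(0 <= n < k | n \in D) (s n)%:C *: rank_one (f n) (g n) h)
          @ \oo --> T h].

Definition schmidt_decomposable T : Prop :=
  exists D s f g, schmidt_decomposition T D s f g.

Definition selfadjoint T : Prop := forall x y, '<T x, y> = '<x, T y>.

Definition positive_op T : Prop := forall x, 0 <= '<T x, x>.

Definition trivial_null T : Prop := forall x, T x = 0 -> x = 0.

Definition orthogonal_projection (P : {linear H -> H}) : Prop :=
  [/\ continuous P, forall x, P (P x) = P x & selfadjoint P].

Definition commutator_op P Q : H -> H := fun x => P (Q x) - Q (P x).

Definition null_space T : set H := [set x | T x = 0].

Definition ortho_compl A : set H := [set x | forall y, A y -> '<x, y> = 0].

(* The summands lie in H11, H00, H10 and H01 respectively. *)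
Definition generic_part P Q : set H :=
  ortho_compl [set x | exists x11 x00 x10 x01 : H,
    [/\ (range P `&` range Q) x11,
        (null_space P `&` null_space Q) x00,
        (range P `&` null_space Q) x10,
        (null_space P `&` range Q) x01 &
        x = x11 + x00 + x10 + x01]].

(* cos X and sin X are the sums of their power series, which converge for
   every bounded X. *)
Definition op_cos T : H -> H := fun v =>
  limn (series (fun k => ((-1) ^+ k / (k.*2)`!%:R : R[i]) *: iter k.*2 T v)).

Definition op_sin T : H -> H := fun v =>
  limn (series (fun k =>
    ((-1) ^+ k / (k.*2.+1)`!%:R : R[i]) *: iter k.*2.+1 T v)).

End Hilbert_defs.

(* [W] is the inverse of the unitary isomorphism from the generic part of
   [P], [Q] onto the Hilbert space L x L, whose inner product is
   <(a, b), (c, d)> = <a, c> + <b, d>. *)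
Record halmos_decomposition (R : realType) (H L : hilbertType R) (P Q : H -> H)
    (W : {linear (L * L)%type -> H}) (X : {linear L -> L}) : Prop := {
  halmos_isometry : forall u v : (L * L)%type,
    '<W u, W v> = '<u.1, v.1> + '<u.2, v.2> ;
  halmos_range : range W = generic_part P Q ;
  halmos_bounded : continuous X ;
  halmos_selfadjoint : selfadjoint X ;
  halmos_ge0 : positive_op X ;
  halmos_le_pi2 : forall v : L, '<X v, v> <= (pi / 2)%:C * '<v, v> ;
  halmos_cos_ge0 : positive_op (op_cos X) ;
  halmos_sin_ge0 : positive_op (op_sin X) ;
  halmos_null : trivial_null X ;
  halmos_cos_null : trivial_null (op_cos X) ;
  halmos_sin_null : trivial_null (op_sin X) ;
  halmos_P : forall a b : L, P (W (a, b)) = W (a, 0) ;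
  halmos_Q : forall a b : L,
    let C := op_cos X in let S := op_sin X in
    Q (W (a, b)) = W (C (C a) + C (S b), C (S a) + S (S b))
}.

(* Main.v *)
Require Import Defs.
From mathcomp Require Import all_boot all_order all_algebra.
From mathcomp Require Import complex.
From mathcomp Require Import all_classical all_reals all_analysis.
From mathcomp Require Import ring lra.

(** Write K for the commutator of P and Q.  The whole proof rests on one
    criterion, [diagonalizable_of_total]: an operator whose adjoint is a scalar
    multiple of itself is diagonalizable as soon as no nonzero vector is
    orthogonal to all its eigenvectors.  It replaces the spectral theorem, and
    reduces each implication below to exhibiting enough eigenvectors.

    From a Schmidt decomposition of PQ to K: a pair of singular vectors
    satisfies PQ g = s f and QP f = s g, so K maps the plane of f and g into
    itself, with eigenvalues plus or minus i s sqrt (1 - s^2) (and f = g is in the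
    kernel of K if s = 1).  A vector orthogonal to all these planes is killed by
    PQ and by QP, hence by K, so it is itself an eigenvector and vanishes
    ([commutator_eigenvectors_total]).  Conversely, if K v = l v with l nonzero,
    then x = P v is a nonzero vector satisfying B^2 x - B x = l^2 x where B = PQP,
    and taking the inner product with some f_n not orthogonal to x gives
    l^2 = s_n^4 - s_n^2 ([singular_of_eigenval]).

    From K to X: in the Halmos model K maps (a, b) to (CS b, - CS a), where
    C = cos X and S = sin X; so if (a, b) is an eigenvector, then a and b are
    eigenvectors of (CS)^2 = C^2 - C^4, and each of them is a sum of at most two
    eigenvectors of C^2, for the roots of a quadratic polynomial
    ([cosX2_split]).  The identity (CS)^2 = C^2 - C^4 is read off from Q^2 = Q;
    no trigonometry of operators enters.  It remains to see that an eigenvector of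
    C^2 is an eigenvector of X ([eigenvector_of_cosX2]).  On the eigenspace of C^2
    for the eigenvalue l, the supremum M and the infimum m of the quadratic form
    of X on unit vectors have approximate eigenvectors of X
    ([approx_eigenvector]), and cos^2 X is close to the scalar cos^2 M on the
    former and to cos^2 m on the latter ([op_cos_sqr_approx]).  Hence
    cos^2 M = l = cos^2 m, so M = m because both lie between 0 and pi / 2, and X
    is a scalar on this eigenspace ([scalar_on_subspace]).

    From X to PQ: if X e = x e, then Q W(e, 0) is an eigenvector of the
    selfadjoint operator QPQ, and these vectors, together with the null space of Q
    and the common range of P and Q, leave no room for a nonzero orthogonal
    vector.  Thus QPQ = (PQ)* (PQ) has an orthonormal basis of eigenvectors, countable
    because H is separable, and expanding along it gives the singular value
    decomposition of PQ ([schmidt_of_diagonal]). *)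

Set Implicit Arguments.
Unset Strict Implicit.
Unset Printing Implicit Defensive.

Import Order.TTheory GRing.Theory Num.Theory.
Import numFieldNormedType.Exports.

Local Open Scope classical_set_scope.
Local Open Scope ring_scope.
Local Open Scope complex_scope.

Local Notation normc := ComplexField.Normc.normc.

(** * Inner products and norms *)

Section InnerProduct.
Variables (R : realType) (H : hilbertType R).
Implicit Types (x y z : H) (a : R[i]).

Lemma dotDl x y z : '<x + y, z> = '<x, z> + '<y, z>.
Proof. exact: linearDl. Qed.
Lemma dotDr x y z : '<x, y + z> = '<x, y> + '<x, z>.
Proof. exact: linearDr. Qed.
Lemma dotNl x y : '<- x, y> = - '<x, y>.
Proof. exact: linearNl. Qed.
Lemma dotNr x y : '<x, - y> = - '<x, y>.
Proof. exact: linearNr. Qed.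
Lemma dotBl x y z : '<x - y, z> = '<x, z> - '<y, z>.
Proof. exact: linearBl. Qed.
Lemma dotBr x y z : '<x, y - z> = '<x, y> - '<x, z>.
Proof. exact: linearBr. Qed.
Lemma dotZl a x y : '<a *: x, y> = a * '<x, y>.
Proof. exact: linearZl_LR. Qed.
Lemma dotZr a x y : '<x, a *: y> = Num.conj a * '<x, y>.
Proof. exact: linearZr_LR. Qed.
Lemma dot0l x : '<0, x> = 0.
Proof. exact: linear0l. Qed.
Lemma dot0r x : '<x, 0> = 0.
Proof. exact: linear0r. Qed.
Lemma dotC x y : '<x, y> = Num.conj '<y, x>.
Proof. by rewrite [LHS]hermC expr0 mul1r. Qed.
Lemma dot_suml (I : Type) (r : seq I) (p : pred I) (F : I -> H) y :
  '<\sum_(i <- r | p i) F i, y> = \sum_(i <- r | p i) '<F i, y>.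
Proof. exact: linear_sumlz. Qed.

Lemma dotC0 x y : '<x, y> = 0 -> '<y, x> = 0.
Proof. by move=> xy0; rewrite dotC xy0 rmorph0. Qed.


(** The norm of a complex Hilbert space takes its values in R[i], which is only
    partially ordered; estimates are made on its real part. *)
Definition rnorm x : R := complex.Re `|x|.

Lemma rnormE x : `|x| = (rnorm x)%:C.
Proof. by rewrite /rnorm RRe_real ?ger0_real. Qed.

Lemma norm_complexE a : `|a| = (normc a)%:C.
Proof. by []. Qed.

Lemma normc_ge0 a : 0 <= normc a.
Proof. by rewrite -ler0c -norm_complexE. Qed.

Lemma rnorm_ge0 x : 0 <= rnorm x.
Proof. by rewrite -ler0c -rnormE. Qed.

Lemma dotxx x : '<x, x> = (rnorm x ^+ 2)%:C.
Proof. by rewrite -hdot_norm rnormE rmorphXn. Qed.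

Lemma rnorm0 : rnorm 0 = 0.
Proof. by rewrite /rnorm normr0. Qed.

Lemma rnorm_eq0 x : rnorm x = 0 -> x = 0.
Proof. by move=> x0; apply/normr0_eq0; rewrite rnormE x0. Qed.

Lemma rnorm_gt0 x : x != 0 -> 0 < rnorm x.
Proof.
move=> x0; rewrite lt_neqAle rnorm_ge0 andbT eq_sym.
by apply: contra_neq x0 => /rnorm_eq0.
Qed.

Lemma dotxx_eq0 x : '<x, x> = 0 -> x = 0.
Proof.
rewrite dotxx => /complexI /eqP; rewrite sqrf_eq0 => /eqP.
exact: rnorm_eq0.
Qed.

Lemma rnormZ a x : rnorm (a *: x) = normc a * rnorm x.
Proof. by apply: complexI; rewrite rmorphM /= -!rnormE -norm_complexE normrZ. Qed.

Lemma rnormN x : rnorm (- x) = rnorm x.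
Proof. by rewrite /rnorm normrN. Qed.

Lemma rnormB x y : rnorm (x - y) = rnorm (y - x).
Proof. by rewrite -rnormN opprB. Qed.

Lemma rnormD x y : rnorm (x + y) <= rnorm x + rnorm y.
Proof. by rewrite -lecR rmorphD /= -!rnormE ler_normD. Qed.

Lemma rnormBD x y z : rnorm (x - z) <= rnorm (x - y) + rnorm (y - z).
Proof. by rewrite -(subrKA y) ?rnormD // [X in rnorm X <= _]addrC rnormD. Qed.

Lemma rnorm_sum (I : Type) (r : seq I) (p : pred I) (F : I -> H) :
  rnorm (\sum_(i <- r | p i) F i) <= \sum_(i <- r | p i) rnorm (F i).
Proof.
elim/big_ind2: _ => //; first by rewrite rnorm0.
by move=> x1 x2 y1 y2 h1 h2; apply: (le_trans (rnormD _ _)); rewrite lerD.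
Qed.

Lemma rnorm_sqr x : rnorm x ^+ 2 = complex.Re '<x, x>.
Proof. by rewrite dotxx. Qed.

Lemma rnorm_sqrD x y :
  rnorm (x + y) ^+ 2 = rnorm x ^+ 2 + rnorm y ^+ 2 + 2 * complex.Re '<x, y>.
Proof.
rewrite !rnorm_sqr dotDl !dotDr (dotC y x).
by case: '<x, y> => p q /=; rewrite !raddfD /=; lra.
Qed.

Lemma rnorm_sqrB x y :
  rnorm (x - y) ^+ 2 = rnorm x ^+ 2 + rnorm y ^+ 2 - 2 * complex.Re '<x, y>.
Proof. by rewrite rnorm_sqrD rnormN dotNr raddfN /=; lra. Qed.

Lemma rnorm_parallelogram x y :
  rnorm (x + y) ^+ 2 + rnorm (x - y) ^+ 2 = 2 * (rnorm x ^+ 2 + rnorm y ^+ 2).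
Proof. by rewrite rnorm_sqrD rnorm_sqrB; lra. Qed.

Lemma normc_sqr a : (normc a ^+ 2)%:C = a * Num.conj a.
Proof. by rewrite rmorphXn /= -norm_complexE normCK. Qed.

Lemma normc_real (r : R) : normc r%:C = `|r|.
Proof. by rewrite /= expr0n addr0 sqrtr_sqr. Qed.

Lemma conj_real (r : R) : Num.conj r%:C = r%:C.
Proof. exact: conjc_real. Qed.

Lemma cauchy_schwarz x y : normc '<x, y> <= rnorm x * rnorm y.
Proof.
have [->|y0] := eqVneq y 0.
  by rewrite dot0r ComplexField.Normc.normc0 rnorm0 mulr0.
rewrite -(ler_pXn2r (n := 2)) ?nnegrE ?mulr_ge0 ?rnorm_ge0 ?normc_ge0 //.
(* A multiple of the component of x orthogonal to y. *)
pose t := '<x, y>; pose z := (rnorm y ^+ 2)%:C *: x - t *: y.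
have y2 : 0 < rnorm y ^+ 2 by rewrite exprn_gt0 ?rnorm_gt0.
have zE : rnorm z ^+ 2 =
    rnorm y ^+ 2 * (rnorm x ^+ 2 * rnorm y ^+ 2 - normc t ^+ 2).
  rewrite rnorm_sqrB !rnormZ normc_real dotZl dotZr -/t (mulrC (Num.conj t)) -normc_sqr.
  by rewrite -rmorphM /= ger0_norm ?sqr_ge0 //; ring.
by rewrite -subr_ge0 exprMn -(pmulr_rge0 _ y2) -zE sqr_ge0.
Qed.

Lemma Re_le_normc a : complex.Re a <= normc a.
Proof.
by case: a => p q /=; rewrite (le_trans (ler_norm p)) // -sqrtr_sqr ler_wsqrtr // lerDl sqr_ge0.
Qed.

(** The radii e of the topology are positive elements of R[i], hence real. *)
Lemma cvg_rnormP (u : nat -> H) x : u @ \oo --> x <->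
  (forall e : R, 0 < e -> exists N, forall n, (N <= n)%N -> rnorm (u n - x) < e).
Proof.
split=> [/cvgrPdist_lt ux e e0|ux].
  have /ux : 0 < e%:C by rewrite ltcR.
  move=> [N _ uN]; exists N => n /uN /=.
  by rewrite rnormE ltcR rnormB.
apply/cvgrPdist_lt => e e0.
have -> : e = (complex.Re e)%:C by rewrite RRe_real // gtr0_real.
move: e0; rewrite ltcE /= => /andP[_ /ux [N uN]].
by exists N => // n /= Nn; rewrite rnormE ltcR rnormB uN.
Qed.

Lemma closure_rnormP (A : set H) x : closure A x <->
  (forall e : R, 0 < e -> exists2 y, A y & rnorm (x - y) < e).
Proof.
split=> [Ax e e0|Ax].
  have : nbhs x (ball x e%:C) by apply: nbhsx_ballx; rewrite ltcR.
  move=> /Ax [y [Ay]]; rewrite -ball_normE /ball_ /= => xy; exists y => //.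
  by move: xy; rewrite rnormE ltcR.
move=> B /nbhs_ballP [e /= e0 xB].
have eE : e = (complex.Re e)%:C by rewrite RRe_real // gtr0_real.
move: e0; rewrite ltcE /= => /andP[_ /Ax [y Ay xy]].
exists y; split => //; apply: xB; rewrite -ball_normE /ball_ /=.
by rewrite eE rnormE ltcR.
Qed.

Lemma rnorm_complete (u : nat -> H) :
  (forall e : R, 0 < e -> exists N, forall m n, (N <= m)%N -> (N <= n)%N ->
     rnorm (u m - u n) < e) ->
  exists x, u @ \oo --> x.
Proof.
move=> cu; suff : cvg (u @ \oo) by move=> /cvg_ex [x ux]; exists x.
apply/cauchy_cvgP; apply/cauchyP => e e0.
have eE : e = (complex.Re e)%:C by rewrite RRe_real // gtr0_real.
move: e0; rewrite ltcE /= => /andP[_ /cu [N uN]].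
exists (u N), N => // n /= Nn; rewrite -ball_normE /ball_ /=.
by rewrite eE rnormE ltcR uN.
Qed.

End InnerProduct.

(** * Projection onto closed subspaces *)

Lemma le0_of_small (R : realType) (r B : R) :
  0 <= B -> (forall e, 0 < e -> r <= e * B) -> r <= 0.
Proof.
move=> B0 small; rewrite leNgt; apply/negP => r0.
have B1 : 0 < B + 1 by lra.
have := small (r / (2 * (B + 1))); rewrite divr_gt0 ?mulr_gt0 // => /(_ isT).
rewrite mulrAC ler_pdivlMr ?mulr_gt0 //; nra.
Qed.

Section Projection.
Variables (R : realType) (H : hilbertType R).
Implicit Types (x y z w : H) (a : R[i]) (A F : set H).

Lemma normc_le0 a : normc a <= 0 -> a = 0.
Proof.
move=> a0; apply: ComplexField.Normc.eq0_normc; apply/eqP.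
by rewrite eq_le a0 normc_ge0.
Qed.

Lemma rnorm_le0 x : rnorm x <= 0 -> x = 0.
Proof. by move=> x0; apply: rnorm_eq0; apply/eqP; rewrite eq_le x0 rnorm_ge0. Qed.

Lemma closure_dot0 A x y :
  closure A x -> (forall z, A z -> '<z, y> = 0) -> '<x, y> = 0.
Proof.
move=> /closure_rnormP Ax Ay; apply: normc_le0.
apply: (le0_of_small (rnorm_ge0 y)) => e /Ax [z Az xz].
rewrite -['<x, y> ]subr0 -(Ay z Az) -dotBl (le_trans (cauchy_schwarz _ _)) //.
by rewrite ler_wpM2r ?rnorm_ge0 // ltW.
Qed.

Lemma cvg_dot_const (u : nat -> H) x y a : u @ \oo --> x ->
  (exists N, forall n, (N <= n)%N -> '<u n, y> = a) -> '<x, y> = a.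
Proof.
move=> /cvg_rnormP ux [N uN]; apply/eqP; rewrite -subr_eq0; apply/eqP.
apply: normc_le0; apply: (le0_of_small (rnorm_ge0 y)) => e /ux [M uM].
have [NM MM] := (leq_maxl N M, leq_maxr N M).
rewrite -(uN _ NM) -dotBl (le_trans (cauchy_schwarz _ _)) //.
by rewrite ler_wpM2r ?rnorm_ge0 // rnormB ltW // uM.
Qed.

Definition subspace F := F 0 /\ forall a x y, F x -> F y -> F (a *: x + y).

Lemma subspaceD F x y : subspace F -> F x -> F y -> F (x + y).
Proof. by move=> [_ Fl] Fx Fy; rewrite -(scale1r x); apply: Fl. Qed.

Lemma subspaceZ F a x : subspace F -> F x -> F (a *: x).
Proof. by move=> [F0 Fl] Fx; rewrite -[a *: x]addr0; apply: Fl. Qed.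

Lemma subspaceB F x y : subspace F -> F x -> F y -> F (x - y).
Proof.
by move=> [_ Fl] Fx Fy; rewrite addrC -scaleN1r; apply: Fl.
Qed.

Lemma ortho_compl_subspace A : subspace (ortho_compl A).
Proof.
split=> [y _|a x y Ax Ay z Az]; first exact: dot0l.
by rewrite dotDl dotZl Ax // Ay // mulr0 addr0.
Qed.

Lemma ortho_compl_closed A : closure (ortho_compl A) `<=` ortho_compl A.
Proof.
move=> x Ax y Ay; apply: (closure_dot0 Ax) => z; exact.
Qed.

Lemma closure_subspace F : subspace F -> subspace (closure F).
Proof.
move=> [F0 Fl]; split; first exact: subset_closure.
move=> a x y /closure_rnormP Fx /closure_rnormP Fy; apply/closure_rnormP => e e0.
have n0 := normc_ge0 a.
have a0 : 0 < 2 * (normc a + 1) by lra.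
have [|x' Fx' xx'] := Fx (e / (2 * (normc a + 1))); first by rewrite divr_gt0.
have [|y' Fy' yy'] := Fy (e / 2); first by rewrite divr_gt0.
exists (a *: x' + y'); first exact: Fl.
rewrite opprD addrACA -scalerBr (le_lt_trans (rnormD _ _)) // rnormZ.
move: xx'; rewrite ltr_pdivlMr // => xx'.
have := rnorm_ge0 (x - x'); nra.
Qed.

Lemma lin_span_subspace A : subspace (lin_span A).
Proof.
split; first by exists 0%N, (fun=> 0), (fun=> 0); split; [case|rewrite big_ord0].
move=> a _ _ [n [c [b [Ab ->]]]] [m [d [b' [Ab' ->]]]].
exists (n + m)%N, (fun i : 'I_(n + m) =>
  match fintype.split i with inl j => a * c j | inr k => d k end).
exists (fun i : 'I_(n + m) => match fintype.split i with inl j => b j | inr k => b' k end); split.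
  by move=> i; case: (fintype.split i).
rewrite big_split_ord /= scaler_sumr; congr (_ + _).
  by apply: eq_bigr => i _; rewrite (unsplitK (inl _)) scalerA.
by apply: eq_bigr => i _; rewrite (unsplitK (inr _)).
Qed.

Lemma lin_span_sub A : A `<=` lin_span A.
Proof.
move=> x Ax; exists 1%N, (fun=> 1), (fun=> x); split => //.
by rewrite big_ord1 scale1r.
Qed.

(** By the parallelogram identity a minimizing sequence is Cauchy. *)
Lemma nearest_point F x : subspace F -> closure F `<=` F ->
  exists2 y, F y & forall z, F z -> rnorm (x - y) <= rnorm (x - z).
Proof.
move=> [F0 Fl] Fc.
pose D := [set rnorm (x - z) | z in F].
have D0 : lbound D 0 by move=> _ [z _ <-]; exact: rnorm_ge0.
have hD : has_inf D by split; [exists (rnorm (x - 0)), 0|exists 0].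
set d := inf D.
have d0 : 0 <= d by apply: lb_le_inf => //; case: hD.
have dle z : F z -> d <= rnorm (x - z).
  by move=> Fz; apply: ge_inf; [case: hD|exists z].
have /choice [u uP] n : exists z, F z /\ rnorm (x - z) < d + n.+1%:R^-1.
  have [|_ [z Fz <-] zd] := inf_adherent (eps := n.+1%:R^-1) _ hD.
    by rewrite invr_gt0 ltr0n.
  by exists z.
have u_lt (e : R) : 0 < e -> exists N, forall n, (N <= n)%N -> rnorm (x - u n) < d + e.
  move=> e0; have [N] := ltr_add_invr e0; rewrite add0r => Ne.
  exists N => n Nn; rewrite (lt_le_trans (uP n).2) // lerD2l (le_trans _ (ltW Ne)) //.
  by rewrite lef_pV2 ?posrE ?ltr0n // ler_nat.
have [|y uy] := @rnorm_complete R H u.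
  (* If two points of F are within d + del of x, so is their midpoint, and the
     square of their distance is at most 4 (2 d + 1) del. *)
  move=> e e0; pose k := 4 * (2 * d + 1) + 1.
  have k0 : 0 < k by rewrite /k; lra.
  pose del := Num.min 1 (e ^+ 2 / k).
  have del0 : 0 < del by rewrite lt_min ltr01 divr_gt0 ?exprn_gt0.
  have del1 : del <= 1 by rewrite ge_min lexx.
  have delk : del * k <= e ^+ 2 by rewrite -ler_pdivlMr // ge_min lexx orbT.
  have [N uN] := u_lt del del0; exists N => m n Nm Nn.
  have um := uN m Nm; have un := uN n Nn.
  rewrite -(ltr_pXn2r (n := 2)) ?nnegrE ?rnorm_ge0 ?ltW //.
  have := rnorm_parallelogram (x - u m) (x - u n).
  have -> : x - u m - (x - u n) = u n - u m.
    by rewrite opprB addrC addrA addrNK.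
  have -> : x - u m + (x - u n) = 2%:C *: (x - 2^-1 *: (u m + u n)).
    rewrite scalerBr scalerA rmorph_nat mulfV ?pnatr_eq0 // scale1r.
    by rewrite opprD addrACA -mulr2n -scaler_nat.
  rewrite rnormZ normc_real ger0_norm // (rnormB (u n)).
  have dw : d <= rnorm (x - 2^-1 *: (u m + u n)).
    apply: dle; apply: subspaceZ (conj F0 Fl) _.
    by apply: subspaceD (conj F0 Fl) _ _; exact: (uP _).1.
  have um0 := rnorm_ge0 (x - u m); have un0 := rnorm_ge0 (x - u n).
  have um2 : rnorm (x - u m) ^+ 2 < (d + del) ^+ 2.
    by rewrite ltr_pXn2r ?nnegrE ?addr_ge0 // ltW.
  have un2 : rnorm (x - u n) ^+ 2 < (d + del) ^+ 2.
    by rewrite ltr_pXn2r ?nnegrE ?addr_ge0 // ltW.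
  have dw2 : d ^+ 2 <= rnorm (x - 2^-1 *: (u m + u n)) ^+ 2.
    by rewrite ler_pXn2r ?nnegrE ?rnorm_ge0.
  rewrite /k in delk; move: dw2 um2 un2 delk del0 del1 d0.
  set A2 := rnorm (x - u m) ^+ 2; set B2 := rnorm (x - u n) ^+ 2.
  rewrite exprMn; set C2 := rnorm (x - _ *: _) ^+ 2.
  set D2 := rnorm (u m - u n) ^+ 2; set E2 := e ^+ 2; nra.
have Fy : F y.
  apply: Fc; apply/closure_rnormP => e e0.
  have [N uN] := (cvg_rnormP _ _).1 uy e e0.
  by exists (u N); [exact: (uP N).1|rewrite rnormB uN].
exists y => // z Fz; apply: le_trans (dle z Fz).
apply/ler_addgt0Pr => e e0.
have e2 : 0 < e / 2 by rewrite divr_gt0.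
have [N uN] := u_lt _ e2.
have [M uM] := (cvg_rnormP _ _).1 uy _ e2.
have := rnormBD x (u (maxn N M)) y.
have := uN _ (leq_maxl N M); have := uM _ (leq_maxr N M); lra.
Qed.

(** If x - y had a nonzero inner product p with z, then moving y by a small
    positive multiple of p z would bring it closer to x. *)
Lemma projection F x : subspace F -> closure F `<=` F ->
  exists2 y, F y & ortho_compl F (x - y).
Proof.
move=> sF /(nearest_point x sF) [y Fy y_near]; exists y => // z Fz.
apply: contrapT => /eqP p0; set p := '<_, _> in p0.
have z0 : 0 < 1 + rnorm z ^+ 2 by rewrite ltr_wpDr ?sqr_ge0.
(* Any r with r |z|^2 < 2 decreases the distance. *)
pose r := (1 + rnorm z ^+ 2)^-1.
have r0 : 0 < r by rewrite invr_gt0.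
have rz : r * rnorm z ^+ 2 < 1.
  by rewrite mulrC ltr_pdivrMr // mul1r ltrDr.
have := y_near (y + (r%:C * p) *: z) (subspaceD sF Fy (subspaceZ _ sF Fz)).
rewrite -(ler_pXn2r (n := 2)) ?nnegrE ?rnorm_ge0 // opprD addrA.
rewrite [leRHS]rnorm_sqrB rnormZ dotZr -/p.
rewrite rmorphM /= conj_real -mulrA (mulrC (Num.conj p)) -normc_sqr -rmorphM /=.
rewrite ComplexField.Normc.normcM normc_real gtr0_norm // !exprMn.
have : 0 < normc p ^+ 2.
  rewrite exprn_gt0 // lt_neqAle normc_ge0 andbT eq_sym.
  by apply: contra_neq p0; exact: ComplexField.Normc.eq0_normc.
set P2 := normc p ^+ 2; set Z2 := rnorm z ^+ 2 in rz *; set S := rnorm _ ^+ 2.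
move=> P0; have : r * P2 * (r * Z2) < r * P2 * 1 by rewrite ltr_pM2l // mulr_gt0.
have : 0 < r * P2 by rewrite mulr_gt0.
nra.
Qed.

(** By [total_dense] and [dense_total] this is density of the linear span. *)
Definition total A := forall w, ortho_compl A w -> w = 0.

Lemma total_dense A : total A -> closure (lin_span A) = setT.
Proof.
move=> At; apply/seteqP; split => // x _.
have sA := closure_subspace (lin_span_subspace A).
have [|y Ay xy] := projection x sA.
  by rewrite -((closure_id _).1 (@closed_closure _ _)).
suff /eqP : x - y = 0 by rewrite subr_eq0 => /eqP ->.
by apply: At => z Az; apply: xy; apply: subset_closure; exact: lin_span_sub.
Qed.

Lemma dense_total A : closure (lin_span A) = setT -> total A.
Proof.
move=> AT w wA; apply: dotxx_eq0.
apply: (@closure_dot0 (lin_span A)); first by rewrite AT.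
move=> _ [n [a [b [Ab ->]]]]; rewrite dot_suml big1 // => i _.
by rewrite dotZl dotC wA // rmorph0 mulr0.
Qed.

Lemma ortho_compl_closure_span A w :
  ortho_compl A w -> ortho_compl (closure (lin_span A)) w.
Proof.
move=> wA x Ax; apply: dotC0; apply: closure_dot0 Ax _.
move=> _ [n [a [b [Ab ->]]]]; rewrite dot_suml big1 // => i _.
by rewrite dotZl dotC wA // rmorph0 mulr0.
Qed.

End Projection.

(** * Diagonalizability and total sets of eigenvectors *)

Section Diagonalization.
Variables (R : realType) (H : hilbertType R).
Implicit Types (x y z w : H) (a : R[i]) (T : H -> H).

Definition eigenvectors T : set H := [set v | exists l : R[i], T v = l *: v].

Lemma linear_fun0 T : linear T -> T 0 = 0.
Proof.
by move=> Tl; have := Tl (-1) 0 0; rewrite scaler0 addr0 scaleN1r addNr.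
Qed.

Lemma linear_funZ T a v : linear T -> T (a *: v) = a *: T v.
Proof. by move=> Tl; have := Tl a v 0; rewrite !addr0 linear_fun0 // addr0. Qed.

Lemma eigenvectors_line T v : linear T -> eigenvectors T v ->
  forall a, eigenvectors T (a *: v).
Proof.
move=> Tl [l Tv] a; exists l.
by rewrite linear_funZ // Tv !scalerA mulrC.
Qed.

(** Zorn's lemma.  Maximality is only exploited on lines contained in E, since
    a vector has to be normalized before it can be added to B. *)
Lemma maximal_orthonormal_subset (E : set H) : exists B : set H,
  [/\ orthonormal_system B idfun, B `<=` E &
      forall w, ortho_compl B w -> (forall a, E (a *: w)) -> w = 0].
Proof.
pose P B := orthonormal_system B (@idfun H) /\ B `<=` E.
have [F FP Ftot|B [[Bo BE] Bmax]] := @Zorn_bigcup _ P.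
  split=> [m n [X FX Xm] [Y FY Yn]|x [X FX]]; last exact: (FP X FX).2.
  have [XY|YX] := Ftot X Y FX FY.
    by apply: (FP Y FY).1 => //; exact: XY.
  by apply: (FP X FX).1 => //; exact: YX.
exists B; split => // w wB wE; apply: contrapT => /eqP w0.
have n0 := rnorm_gt0 w0.
pose u := (rnorm w)^-1%:C *: w.
have uB m : B m -> '<u, m> = 0 by move=> Bm; rewrite dotZl wB // mulr0.
have u1 : '<u, u> = 1.
  rewrite dotxx rnormZ normc_real ger0_norm ?invr_ge0 ?ltW //.
  by rewrite mulVf ?gt_eqF // expr1n.
have uNB : ~ B u by move=> /uB; rewrite u1 => /eqP; rewrite oner_eq0.
apply: (Bmax (B `|` [set u])).
  split=> [m|]; first by left.
  by move=> /(_ u) BB; apply: uNB; apply: BB; right.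
split=> [m n|x]; last by case=> [/BE //|->]; exact: wE.
case=> [Bm|->] [Bn|->] /=.
- exact: Bo.
- have [mu|_] := eqVneq; first by case: uNB; rewrite -mu.
  by apply: dotC0; exact: uB.
- have [um|_] := eqVneq; first by case: uNB; rewrite um.
  exact: uB.
- by rewrite u1 eqxx.
Qed.

(** The hypothesis on the adjoint, satisfied by selfadjoint and by
    skew-adjoint operators, makes T leave invariant the orthogonal complement of
    every set of its eigenvectors; thus the component of an eigenvector in such a
    complement is again an eigenvector, for the same eigenvalue, and a maximal
    orthonormal set of eigenvectors has to be a basis. *)
Lemma diagonalizable_of_total T (e : R[i]) : linear T ->
  (forall x y, '<T x, y> = e * '<x, T y>) -> total (eigenvectors T) ->
  diagonalizable_op T.
Proof.
move=> Tl Tadj Ttot.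
have [B [Bo BE Bmax]] := maximal_orthonormal_subset (eigenvectors T).
exists B; split; last by move=> b /BE.
split => //; apply: total_dense => w wB; apply: Ttot => v [l Tv].
have TB z : ortho_compl B z -> ortho_compl B (T z).
  move=> zB b Bb; have [m Tb] := BE b Bb.
  by rewrite Tadj Tb dotZr zB // !mulr0.
have [|y By vy] := projection v (closure_subspace (lin_span_subspace B)).
  by rewrite -((closure_id _).1 (@closed_closure _ _)).
set z := v - y in vy.
have zB : ortho_compl B z.
  by move=> b Bb; apply: vy; apply: subset_closure; exact: lin_span_sub.
have Tz : T z = T v - T y by rewrite /z addrC -scaleN1r Tl scaleN1r addrC.
suff Tzl : T z = l *: z.
  have z0 : z = 0 by apply: Bmax => // a; apply: eigenvectors_line => //; exists l.
  have -> : v = y by apply/eqP; rewrite -subr_eq0; apply/eqP.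
  exact: (ortho_compl_closure_span wB).
apply/eqP; rewrite -subr_eq0; apply/eqP; apply: dotxx_eq0.
have zB' : ortho_compl B (T z - l *: z).
  apply: subspaceB (TB _ zB) _; first exact: ortho_compl_subspace.
  by apply: subspaceZ zB; exact: ortho_compl_subspace.
rewrite [X in '<_, X> ](_ : _ = l *: y - T y); last first.
  by rewrite Tz Tv /z scalerBr opprB addrC addrA subrK.
have yM x : ortho_compl B x -> '<y, x> = 0.
  by move=> /ortho_compl_closure_span xB; apply: dotC0; exact: xB.
rewrite dotBr dotZr (dotC _ y) yM // rmorph0 mulr0 sub0r dotC.
by rewrite Tadj yM ?mulr0 ?rmorph0 ?oppr0 //; exact: TB.
Qed.

End Diagonalization.

(** * The cosine of a bounded operator *)

Section Sequences.
Variables (R : realType) (H : hilbertType R).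
Implicit Types (x y z w : H) (a : R[i]) (u v : nat -> H).

Lemma rnorm_cvg_unique u x y : u @ \oo --> x -> u @ \oo --> y -> x = y.
Proof. by move=> ux uy; apply: (cvg_unique _ ux uy). Qed.

Lemma eq_cvg_seq u v x : u =1 v -> u @ \oo --> x -> v @ \oo --> x.
Proof. by move=> /funext ->. Qed.

Lemma cvg_lincomb u v x y a : u @ \oo --> x -> v @ \oo --> y ->
  (fun n => a *: u n + v n) @ \oo --> a *: x + y.
Proof. by move=> ux vy; apply: cvgD => //; exact: cvgZl_tmp. Qed.

Lemma cvg_bounded_op (T : {linear H -> H}) (K : R) u x :
  (forall y, rnorm (T y) <= K * rnorm y) ->
  u @ \oo --> x -> (fun n => T (u n)) @ \oo --> T x.
Proof.
move=> TK /cvg_rnormP ux; apply/cvg_rnormP => e e0.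
have K1 : 0 < 1 + `|K| by rewrite ltr_wpDr.
have [|N uN] := ux (e / (1 + `|K|)); first by rewrite divr_gt0.
exists N => n /uN; rewrite -raddfB ltr_pdivlMr // => un.
apply: le_lt_trans un; rewrite (le_trans (TK _)) // mulrC.
rewrite ler_wpM2l ?rnorm_ge0 // (le_trans (ler_norm _)) // lerDr //.
Qed.

Lemma cvg_rnorm_le u x (B : R) : u @ \oo --> x ->
  (forall n, rnorm (u n) <= B) -> rnorm x <= B.
Proof.
move=> /cvg_rnormP ux uB; apply/ler_addgt0Pr => e /ux [N /(_ N (leqnn _))].
have := rnormD (x - u N) (u N); rewrite subrK (rnormB x); have := uB N; lra.
Qed.

Lemma cvg_series_dominated u (b : nat -> R) :
  (forall k, rnorm (u k) <= b k) -> cvgn (series b) ->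
  exists x, series u @ \oo --> x.
Proof.
move=> ub /cauchy_cvgP/cauchyP cb; apply: rnorm_complete => e e0.
have [c [N _ cN]] := cb (e / 2) (divr_gt0 e0 (ltr0n _ 2)).
have key m n : (N <= m)%N -> (m <= n)%N -> rnorm (series u n - series u m) < e.
  move=> Nm mn; rewrite sub_series_geq //.
  apply: le_lt_trans (rnorm_sum _ _ _) _.
  apply: (@le_lt_trans _ _ (series b n - series b m)).
    by rewrite sub_series_geq //; apply: ler_sum => k _.
  have := cN m Nm; have := cN n (leq_trans Nm mn).
  rewrite -ball_normE /ball_ /= !ltr_norml => /andP[? ?] /andP[? ?]; lra.
exists N => m n Nm Nn; have [mn|/ltnW nm] := leqP m n; last exact: key.
by rewrite rnormB key.
Qed.

Lemma cvg_scale_real (c : nat -> R) (l : R) x : c @ \oo --> l ->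
  (fun n => (c n)%:C *: x) @ \oo --> l%:C *: x.
Proof.
move=> /cvgrPdist_lt cl; apply/cvg_rnormP => e e0.
have x1 : 0 < 1 + rnorm x by rewrite ltr_wpDr ?rnorm_ge0.
have [|N _ cN] := cl (e / (1 + rnorm x)); first by rewrite divr_gt0.
exists N => n /cN /=; rewrite -scalerBl -rmorphB rnormZ normc_real distrC.
rewrite ltr_pdivlMr // => cn; apply: le_lt_trans cn.
by rewrite ler_wpM2l // lerDr.
Qed.

End Sequences.

Section CosineOfOperator.
Variables (R : realType) (H : hilbertType R) (X : {linear H -> H}) (K : R).
Hypotheses (K1 : 1 <= K) (XK : forall v, rnorm (X v) <= K * rnorm v).
Implicit Types (v w : H) (M : R).

Let K0 : 0 <= K. Proof. exact: le_trans K1. Qed.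

Let term k v : H := ((-1) ^+ k / (k.*2)`!%:R : R[i]) *: iter k.*2 X v.

Lemma iter_linear j a v w : iter j X (a *: v + w) = a *: iter j X v + iter j X w.
Proof. by elim: j => //= j ->; rewrite linearP. Qed.

Lemma rnorm_iter j v : rnorm (iter j X v) <= K ^+ j * rnorm v.
Proof.
elim: j => [|j IH] /=; first by rewrite mul1r.
by rewrite (le_trans (XK _)) // exprS -mulrA ler_wpM2l.
Qed.

(** Factoring X^(j+1) - M^(j+1) as X (X^j - M^j) + M^j (X - M); the bound
    j K^(j-1) that this gives is coarsened to (2 K)^j. *)
Lemma rnorm_iter_sub j M v : `|M| <= K ->
  rnorm (iter j X v - (M ^+ j)%:C *: v) <= (2 * K) ^+ j * rnorm (X v - M%:C *: v).
Proof.
move=> MK; elim: j => [|j IH] /=; first by rewrite scale1r subrr rnorm0 mul1r rnorm_ge0.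
have -> : X (iter j X v) - (M ^+ j.+1)%:C *: v =
    X (iter j X v - (M ^+ j)%:C *: v) + (M ^+ j)%:C *: (X v - M%:C *: v).
  by rewrite linearB [X (_ *: _)]linearZ /= scalerBr scalerA -rmorphM -exprSr addrA subrK.
rewrite (le_trans (rnormD _ _)) // rnormZ normc_real.
rewrite exprS -mulrA (le_trans (lerD (XK _) (lexx _))) //.
have := rnorm_ge0 (X v - M%:C *: v); move: IH; set E := rnorm (X v - _).
set a := rnorm _ => IH E0.
have M2 : `|M ^+ j| <= (2 * K) ^+ j.
  rewrite normrX lerXn2r ?nnegrE ?mulr_ge0 //.
  by rewrite (le_trans MK) // ler_peMl // ler1n.
have := ler_wpM2l K0 IH.
have := ler_wpM2r E0 M2.
have : 1 * ((2 * K) ^+ j * E) <= K * ((2 * K) ^+ j * E).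
  by rewrite ler_wpM2r // mulr_ge0 // exprn_ge0 // mulr_ge0.
lra.
Qed.

Let normc_coeff k : normc ((-1) ^+ k / (k.*2)`!%:R : R[i]) = (k.*2)`!%:R^-1.
Proof.
apply: complexI; rewrite -norm_complexE normrM normrX normrN1 expr1n mul1r.
by rewrite normfV normr_nat fmorphV rmorph_nat.
Qed.

Let inv_fact_le k : ((k.*2)`!%:R^-1 : R) <= (k`!%:R)^-1.
Proof.
rewrite lef_pV2 ?posrE ?ltr0n ?fact_gt0 // ler_nat.
case: k => // k; apply/ltnW/ltn_fact => //; rewrite doubleS !ltnS.
by rewrite -addnn leq_addr.
Qed.

Lemma op_cos_cvg v : series (term^~ v) @ \oo --> op_cos X v.
Proof.
have [||x ux] := @cvg_series_dominated R H (term^~ v)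
    (fun k => exp_coeff (K ^+ 2) k * rnorm v).
- move=> k; rewrite rnormZ normc_coeff /exp_coeff /= -mulrA mulrCA.
  rewrite -exprM mul2n; apply: ler_pM; rewrite ?rnorm_ge0 ?invr_ge0 ?inv_fact_le //.
  exact: rnorm_iter.
- rewrite (_ : series _ = fun n => series (exp_coeff (K ^+ 2)) n * rnorm v).
    exact: (is_cvgM (is_cvg_series_exp_coeff _) (is_cvg_cst _)).
  by apply/funext => n; rewrite /series /= mulr_suml.
exact: (cvgP _ ux).
Qed.

Lemma op_cos_linear : linear (op_cos X).
Proof.
move=> a v w; apply: (@rnorm_cvg_unique _ _ (series (term^~ (a *: v + w)))).
  exact: op_cos_cvg.
apply: eq_cvg_seq (@cvg_lincomb R H _ _ _ _ a (@op_cos_cvg v) (@op_cos_cvg w)) => n.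
 rewrite /series /= scaler_sumr -big_split.
apply: eq_bigr => k _; rewrite /= /term iter_linear scalerDr !scalerA.
by rewrite mulrC.
Qed.

Lemma op_cos_comm v : op_cos X (X v) = X (op_cos X v).
Proof.
apply: (@rnorm_cvg_unique _ _ (series (term^~ (X v)))); first exact: op_cos_cvg.
apply: eq_cvg_seq (@cvg_bounded_op R H X K _ _ XK (@op_cos_cvg v)) => n.
 rewrite /series /= linear_sum.
by apply: eq_bigr => k _; rewrite linearZ /= -iterS iterSr.
Qed.

(** An approximate eigenvector of X for the real number M is one of cos X for
    cos M: the two cosine series are compared term by term, and the factorials
    (2 k)! >= k! leave an exponential series as a bound. *)
Lemma op_cos_approx M v : `|M| <= K ->
  rnorm (op_cos X v - (cos M)%:C *: v) <=
  expR ((2 * K) ^+ 2) * rnorm (X v - M%:C *: v).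
Proof.
move=> MK.
have lim := @cvg_lincomb R H _ _ _ _ (-1)
  (@cvg_scale_real R H _ _ v (@cvg_cos_coeff' R M)) (@op_cos_cvg v).
rewrite addrC -scaleN1r; apply: (cvg_rnorm_le lim) => n.
rewrite scaleN1r addrC /series /= rmorph_sum scaler_suml -sumrB.
rewrite (le_trans (rnorm_sum _ _ _)) //.
apply: (@le_trans _ _ (series (exp_coeff ((2 * K) ^+ 2)) n * rnorm (X v - M%:C *: v))).
  rewrite /series /= mulr_suml; apply: ler_sum => k _.
  have -> : term k v - (cos_coeff' M k)%:C *: v =
      ((-1) ^+ k / (k.*2)`!%:R : R[i]) *: (iter k.*2 X v - (M ^+ k.*2)%:C *: v).
    rewrite scalerBr scalerA; congr (_ - _ *: _).
    rewrite /cos_coeff' !rmorphM /= fmorphV rmorph_nat mulrAC. congr (_ / _ * _).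
    by rewrite -exprnP rmorphXn rmorphN1.
  rewrite rnormZ normc_coeff /exp_coeff /= mulrAC -exprM mul2n [leRHS]mulrC.
  rewrite ler_pM ?rnorm_ge0 ?invr_ge0 ?inv_fact_le //; exact: rnorm_iter_sub.
rewrite ler_wpM2r ?rnorm_ge0 //; apply: nondecreasing_cvgn_le.
  apply: nondecreasing_series => k _ _; apply: exp_coeff_ge0.
  by rewrite sqr_ge0.
exact: is_cvg_series_exp_coeff.
Qed.

(** The case M = 0 of the comparison, where cos M v = v. *)
Lemma op_cos_bounded : exists2 B, 0 <= B & forall v, rnorm (op_cos X v) <= B * rnorm v.
Proof.
have B0 : 0 <= expR ((2 * K) ^+ 2) * K by rewrite mulr_ge0 ?expR_ge0.
exists (1 + expR ((2 * K) ^+ 2) * K) => [|v]; first by rewrite addr_ge0.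
have := @op_cos_approx 0 v; rewrite normr0 => /(_ K0).
rewrite cos0 scale0r subr0 scale1r => le1.
have := rnormD (op_cos X v - v) v; rewrite subrK.
have := ler_wpM2l (expR_ge0 ((2 * K) ^+ 2)) (XK v).
by rewrite mulrA; lra.
Qed.

Lemma op_cos_sqr_approx : exists2 B, 0 <= B & forall M v, `|M| <= K ->
  rnorm (op_cos X (op_cos X v) - ((cos M) ^+ 2)%:C *: v) <=
  B * rnorm (X v - M%:C *: v).
Proof.
have [B B0 CB] := op_cos_bounded.
pose E := expR ((2 * K) ^+ 2); have E0 : 0 <= E := expR_ge0 _.
exists ((B + 1) * E) => [|M v MK]; first by rewrite mulr_ge0 ?addr_ge0.
set d := op_cos X v - (cos M)%:C *: v.
have -> : op_cos X (op_cos X v) - ((cos M) ^+ 2)%:C *: v =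
    op_cos X d + (cos M)%:C *: d.
  have -> : op_cos X d = op_cos X (op_cos X v) - (cos M)%:C *: op_cos X v.
    by rewrite /d addrC -scaleNr op_cos_linear scaleNr addrC.
  by rewrite /d scalerBr scalerA -rmorphM addrA subrK.
have dle : rnorm d <= E * rnorm (X v - M%:C *: v) by exact: op_cos_approx.
have d0 := rnorm_ge0 d.
apply: le_trans (rnormD _ _) _; rewrite rnormZ normc_real.
have c1 : `|cos M| <= 1 by rewrite ler_norml cos_geN1 cos_le1.
have := CB d; have := ler_wpM2r d0 c1; have := ler_wpM2l B0 dle.
by rewrite mul1r -mulrA mulrDl mul1r; lra.
Qed.

End CosineOfOperator.

(** * Extremal approximate eigenvectors of selfadjoint operators *)

Section SpectralBounds.
Variables (R : realType) (H : hilbertType R).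
Implicit Types (x y z v w : H) (T A : H -> H) (E : set H).

Local Notation form T v := (complex.Re '<T v, v>).

Lemma Re_realM (r : R) (z : R[i]) : complex.Re (r%:C * z) = r * complex.Re z.
Proof. by case: z => p q /=; rewrite mul0r subr0. Qed.

(** Evaluating the nonnegative form of A at the vector v - A v / K. *)
Lemma positive_form_bound A E (K : R) v : linear A -> selfadjoint A ->
  subspace E -> (forall w, E w -> E (A w)) -> 0 < K ->
  (forall w, E w -> 0 <= form A w <= K * rnorm w ^+ 2) ->
  E v -> rnorm (A v) ^+ 2 <= K * form A v.
Proof.
move=> Al As sE EA K0 bnd Ev; have EAv := EA v Ev.
pose t := K^-1.
have Ew : E ((- t)%:C *: A v + v) by exact: sE.2.
have /andP[+ _] := bnd _ Ew; have /andP[_] := bnd _ EAv.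
rewrite Al !dotDl !dotDr !dotZl !dotZr !conj_real.
rewrite !raddfD /= !Re_realM (As (A v) v) -rnorm_sqr.
set p := complex.Re _; set q := rnorm _ ^+ 2; set r := complex.Re _ => pq pos.
have tp : t * p <= q by rewrite mulrC ler_pdivrMr // mulrC.
have : 0 <= K * (- t * (- t * p) + - t * q + (- t * q + r)) by rewrite mulr_ge0 // ltW.
have -> : K * (- t * (- t * p) + - t * q + (- t * q + r)) =
    (K * t) * (t * p) - (K * t) * (2 * q) + K * r by ring.
by rewrite mulfV ?gt_eqF // !mul1r; lra.
Qed.

(** M is the supremum of the form of T on the unit vectors of E.  The form of
    M - T is nonnegative on E, so by the preceding bound M - T is small on every
    unit vector where its form is small. *)
Lemma approx_eigenvector T E (a b : R) : linear T -> selfadjoint T ->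
  subspace E -> (forall w, E w -> E (T w)) -> (exists2 v, E v & v != 0) ->
  (forall v, E v -> a * rnorm v ^+ 2 <= form T v <= b * rnorm v ^+ 2) ->
  exists M, [/\ a <= M <= b, forall v, E v -> form T v <= M * rnorm v ^+ 2 &
    forall e, 0 < e -> exists v, [/\ E v, rnorm v = 1 & rnorm (T v - M%:C *: v) <= e]].
Proof.
move=> Tl Ts sE ET [v0 Ev0 v00] bnd.
pose S := [set form T v | v in [set v | E v /\ rnorm v = 1]].
have normalize v : v != 0 -> rnorm ((rnorm v)^-1%:C *: v) = 1.
  move=> /rnorm_gt0 n0; rewrite rnormZ normc_real ger0_norm ?invr_ge0 ?ltW //.
  by rewrite mulVf ?gt_eqF.
have Sb : ubound S b.
  by move=> _ [v [Ev v1] <-]; have /andP[_] := bnd v Ev; rewrite v1 expr1n mulr1.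
have S0 : S !=set0.
  exists (form T ((rnorm v0)^-1%:C *: v0)), ((rnorm v0)^-1%:C *: v0) => //.
  by split; [exact: subspaceZ|exact: normalize].
have hS : has_sup S by split => //; exists b.
have form_le v : E v -> form T v <= sup S * rnorm v ^+ 2.
  have [->|v_neq0] := eqVneq v 0.
    by rewrite dot0r rnorm0 expr0n mulr0.
  move=> Ev; have n0 := rnorm_gt0 v_neq0.
  rewrite -ler_pdivrMr ?exprn_gt0 //.
  apply: sup_ubound; first by case: hS.
  exists ((rnorm v)^-1%:C *: v).
    by split; [exact: subspaceZ|exact: normalize].
  rewrite linear_funZ // dotZl dotZr conj_real !Re_realM mulrA mulrC.
  by rewrite -expr2 exprVn.
have aS : a <= sup S.
  case: S0 => s [v [Ev v1] vs]; have /andP[+ _] := bnd v Ev.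
  rewrite v1 expr1n mulr1 => av; apply: le_trans av _.
  by apply: sup_ubound; [case: hS|exists v].
have Sb' : sup S <= b by apply: ge_sup.
exists (sup S); split; [by rewrite aS|exact: form_le|move=> e e0].
set M := sup S in form_le aS Sb' *.
pose A v := M%:C *: v - T v.
have Al : linear A.
  move=> c x y; rewrite /A Tl scalerDr opprD addrACA scalerBr.
  by rewrite !scalerA mulrC.
have As : selfadjoint A.
  by move=> x y; rewrite /A dotBl dotBr dotZl dotZr conj_real Ts.
have EA w : E w -> E (A w) by move=> Ew; apply: subspaceB; [|exact: subspaceZ|exact: ET].
have AE v : form A v = M * rnorm v ^+ 2 - form T v.
  by rewrite /A dotBl dotZl raddfB /= Re_realM -rnorm_sqr.
pose K := M - a + 1.
have K0 : 0 < K by rewrite /K; lra.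
have Abnd w : E w -> 0 <= form A w <= K * rnorm w ^+ 2.
  move=> Ew; rewrite AE; have /andP[aw _] := bnd w Ew.
  have := form_le w Ew; have := sqr_ge0 (rnorm w); rewrite /K; nra.
have eK : 0 < e ^+ 2 / K by rewrite divr_gt0 ?exprn_gt0.
have [_ [v [Ev v1] <-] vS] := sup_adherent eK hS.
exists v; split => //; rewrite rnormB -/(A v).
rewrite -(ler_pXn2r (n := 2)) ?nnegrE ?rnorm_ge0 ?(ltW e0) //.
apply: le_trans (positive_form_bound Al As sE EA K0 Abnd Ev) _.
rewrite AE v1 expr1n mulr1 [leLHS]mulrC -ler_pdivlMr //; move: vS; rewrite -/M; lra.
Qed.

(** G plays the role of phi (T) for an injective function phi, but only its
    behaviour on approximate eigenvectors of T matters.  If G is the scalar l on E,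
    then the supremum and the infimum of the form of T on unit vectors of E both
    have image l under phi, so they coincide. *)
Lemma scalar_on_subspace T E (a b : R) (phi : R -> R) (G : H -> H) (B : R) (l : R[i]) :
  linear T -> selfadjoint T -> subspace E -> (forall w, E w -> E (T w)) ->
  (forall v, E v -> a * rnorm v ^+ 2 <= form T v <= b * rnorm v ^+ 2) ->
  0 <= B ->
  (forall M v, a <= M <= b ->
     rnorm (G v - (phi M)%:C *: v) <= B * rnorm (T v - M%:C *: v)) ->
  (forall M M', a <= M <= b -> a <= M' <= b -> phi M = phi M' -> M = M') ->
  (forall v, E v -> G v = l *: v) ->
  exists x : R, forall v, E v -> T v = x%:C *: v.
Proof.
move=> Tl Ts sE ET bnd B0 Gphi phi_inj GE.
have [[v0 Ev0 v00]|E0] := pselect (exists2 v, E v & v != 0); last first.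
  exists 0 => v Ev; have -> : v = 0.
    by apply: contrapT => /eqP v0; apply: E0; exists v.
  by rewrite linear_fun0 // scaler0.
have phiE M : a <= M <= b -> (forall e, 0 < e -> exists v,
    [/\ E v, rnorm v = 1 & rnorm (T v - M%:C *: v) <= e]) -> l = (phi M)%:C.
  move=> Mab approx; apply/eqP; rewrite -subr_eq0; apply/eqP.
  apply: normc_le0; apply: (le0_of_small B0) => e /approx [v [Ev v1 Tv]].
  have := Gphi M v Mab; rewrite GE // -scalerBl rnormZ v1 mulr1 => /le_trans; apply.
  by rewrite mulrC ler_wpM2r.
have [M [Mab TM Mapp]] := approx_eigenvector Tl Ts sE ET (ex_intro2 _ _ v0 Ev0 v00) bnd.
(* The infimum for T is the opposite of the supremum for - T. *)
pose N v := - T v.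
have Nl : linear N by move=> c x y; rewrite /N Tl opprD scalerN.
have Ns : selfadjoint N by move=> x y; rewrite /N dotNl dotNr Ts.
have EN w : E w -> E (N w).
  by move=> /ET Ew; rewrite /N -scaleN1r; exact: subspaceZ.
have NE v : form N v = - form T v by rewrite /N dotNl raddfN.
have [|m [mab Nm mapp]] := @approx_eigenvector N E (- b) (- a) Nl Ns sE EN
  (ex_intro2 _ _ v0 Ev0 v00).
  by move=> v /bnd; rewrite NE !mulNr !lerN2 andbC.
have m'ab : a <= - m <= b by rewrite lerNr lerNl andbC.
have lm : l = (phi (- m))%:C.
  apply: phiE => // e /mapp [v [Ev v1 Nv]]; exists v; split => //.
  have -> : T v - (- m)%:C *: v = - (N v - m%:C *: v).
    by rewrite /N opprD !opprK rmorphN scaleNr opprK.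
  by rewrite rnormN.
have Mm : M = - m.
  by apply: phi_inj => //; apply: complexI; rewrite -lm; apply/esym; exact: phiE.
exists M => v Ev.
pose A v := M%:C *: v - T v.
have Al : linear A.
  move=> c x y; rewrite /A Tl scalerDr opprD addrACA scalerBr.
  by rewrite !scalerA mulrC.
have As : selfadjoint A.
  by move=> x y; rewrite /A dotBl dotBr dotZl dotZr conj_real Ts.
have AE w : E w -> form A w = 0.
  move=> Ew; have := TM w Ew; have := Nm w Ew; rewrite NE.
  by rewrite /A dotBl dotZl raddfB /= Re_realM -rnorm_sqr Mm; lra.
have EA w : E w -> E (A w) by move=> Ew; apply: subspaceB; [|exact: subspaceZ|exact: ET].
have := positive_form_bound (K := 1) Al As sE EA ltr01 _ Ev.
rewrite AE // mulr0 => /(_ _) Av.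
suff /eqP : A v = 0 by rewrite subr_eq0 => /eqP.
apply: rnorm_eq0; apply/eqP; rewrite -sqrf_eq0 eq_le sqr_ge0 andbT.
by apply: Av => w Ew; rewrite AE // lexx mul1r sqr_ge0.
Qed.

End SpectralBounds.

(** * Fourier expansions and Schmidt decompositions *)

Section Fourier.
Variables (R : realType) (H : hilbertType R).
Implicit Types (x y z h : H) (B : set H).

(** Distinct vectors of B are at distance sqrt 2 > 1, so they are approximated
    within 1/2 by distinct points of a countable dense set. *)
Lemma orthonormal_countable B :
  separable_space H -> orthonormal_system B idfun -> countable B.
Proof.
move=> [A [Ac Ad]] Bo.
have near x : exists2 a, A a & rnorm (x - a) < 2^-1.
  have [||a [xa Aa]] := Ad (ball x (2^-1)%:C).
  - by exists x; apply: ballxx; rewrite ltcR invr_gt0.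
  - exact: ball_open.
  exists a => //; move: xa; rewrite -ball_normE /ball_ /=.
  by rewrite rnormE ltcR.
have /choice [p pP] x : exists a, A a /\ rnorm (x - a) < 2^-1.
  by have [a Aa xa] := near x; exists a.
have /countable_injP [f f_inj] := Ac.
apply/countable_injP; exists (f \o p) => x y; rewrite !in_setE /= => Bx By fxy.
have pxy : p x = p y.
  by apply: f_inj; rewrite ?in_setE //; [exact: (pP x).1|exact: (pP y).1].
apply: contrapT => /eqP xy.
have : rnorm (x - y) ^+ 2 = 2.
  rewrite rnorm_sqrB !rnorm_sqr !Bo // !eqxx (negbTE xy) /=; lra.
have := rnormBD x (p x) y; have := (pP x).2; have := (pP y).2.
rewrite pxy (rnormB (p y)); have := rnorm_ge0 (x - y).
set r := rnorm (x - y) => r0 h1 h2 h3; have : r < 1 by lra.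
nra.
Qed.

Variables (D : set nat) (g : nat -> H).
Hypothesis go : orthonormal_system D g.

Definition fourier_sum k h := \sum_(0 <= n < k | n \in D) '<h, g n> *: g n.

Lemma fourier_sumB k x y :
  fourier_sum k (x - y) = fourier_sum k x - fourier_sum k y.
Proof.
by rewrite /fourier_sum -sumrB; apply: eq_bigr => n _; rewrite dotBl scalerBl.
Qed.

Lemma fourier_sum_ortho k h m : (m < k)%N -> D m -> '<h - fourier_sum k h, g m> = 0.
Proof.
move=> mk Dm; rewrite dotBl /fourier_sum big_mkord dot_suml.
rewrite (bigD1 (Ordinal mk)) /= ?in_setE // dotZl go // eqxx mulr1 big1 ?addr0 ?subrr //.
move=> i /andP[/set_mem Di im]; rewrite dotZl go //.
by rewrite -val_eqE /= in im; rewrite (negbTE im) mulr0.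
Qed.

Lemma fourier_sum_dist k h : rnorm (h - fourier_sum k h) <= rnorm h.
Proof.
have ortho : '<h - fourier_sum k h, fourier_sum k h> = 0.
  rewrite dotC {1}/fourier_sum big_mkord dot_suml big1 ?rmorph0 // => i /set_mem Di.
  by rewrite dotZl (dotC (g i)) fourier_sum_ortho // rmorph0 mulr0.
rewrite -(ler_pXn2r (n := 2)) ?nnegrE ?rnorm_ge0 //.
have -> : rnorm h ^+ 2 = rnorm (h - fourier_sum k h + fourier_sum k h) ^+ 2.
  by rewrite subrK.
by rewrite rnorm_sqrD ortho mulr0 addr0 lerDl sqr_ge0.
Qed.

Lemma fourier_sum_id k m : (m < k)%N -> D m -> fourier_sum k (g m) = g m.
Proof.
move=> mk Dm; rewrite /fourier_sum big_mkord (bigD1 (Ordinal mk)) /= ?in_setE //.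
rewrite go // eqxx scale1r big1 ?addr0 // => i /andP[/set_mem Di im].
by rewrite go // eq_sym; rewrite -val_eqE /= in im; rewrite (negbTE im) scale0r.
Qed.

(** A vector y of the span is equal to its partial Fourier sums from some rank
    on, and h - y does not grow when its partial Fourier sum is subtracted. *)
Lemma fourier_cvg h : closure (lin_span (g @` D)) = setT ->
  fourier_sum^~ h @ \oo --> h.
Proof.
move=> gT; apply/cvg_rnormP => e e0.
have /closure_rnormP /(_ e e0) [_ [n [a [b [gb ->]]]] hy] : closure (lin_span (g @` D)) h.
  by rewrite gT.
set y := \sum_(i < n) _ in hy.
have /choice [c cP] i : exists m, D m /\ g m = b i.
  by have [m Dm mi] := gb i; exists m.
exists (\max_(i < n) c i).+1 => k nk.
have yk : fourier_sum k y = y.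
  rewrite /y; under [RHS]eq_bigr => i _.
    rewrite -(cP i).2 -(@fourier_sum_id k (c i)) ?(cP i).2; first over.
    + by rewrite (leq_trans _ nk) // ltnS leq_bigmax.
    + exact: (cP i).1.
  rewrite /fourier_sum; under [RHS]eq_bigr do rewrite scaler_sumr.
  rewrite exchange_big /=; apply: eq_bigr => m _.
  by rewrite dot_suml scaler_suml; apply: eq_bigr => i _; rewrite dotZl scalerA.
rewrite rnormB; apply: le_lt_trans hy.
have -> : h - fourier_sum k h = h - y - fourier_sum k (h - y).
  by rewrite fourier_sumB yk opprB addrA subrK.
exact: fourier_sum_dist.
Qed.

End Fourier.

Section SchmidtFromDiagonal.
Variables (R : realType) (H : hilbertType R) (U : {linear H -> H}) (V : H -> H).

(** Here V is U* U.  The right singular vectors of U are the basis vectors that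
    U does not kill; U sends the Fourier expansion of h along the whole basis to its
    singular value expansion, the terms in the kernel of U dropping out. *)
Lemma schmidt_of_diagonal (K : R) : separable_space H ->
  (forall x, rnorm (U x) <= K * rnorm x) ->
  (forall x y, '<U x, U y> = '<V x, y>) ->
  diagonalizable_op V -> schmidt_decomposable U.
Proof.
move=> Hsep UK UV [B [[Bo BT] Beig]].
have /countable_injP [f f_inj] := orthonormal_countable Hsep Bo.
pose g n := xget 0 [set z | B z /\ f z = n].
pose D' := f @` B.
have gP n : D' n -> B (g n) /\ f (g n) = n.
  by move=> [z Bz fz]; apply: (@xgetPex _ 0 [set z | B z /\ f z = n]); exists z.
clearbody g.
have go : orthonormal_system D' g.
  move=> m n /gP [Bm fm] /gP [Bn fn]; rewrite Bo //=; congr (_ %:R).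
  by congr nat_of_bool; apply/eqP/eqP => [gmn|->//]; rewrite -fm gmn fn.
have gT : closure (lin_span (g @` D')) = setT.
  suff -> : g @` D' = B by [].
  apply/seteqP; split=> [_ [n /gP [Bn _] <-] //|z Bz].
  have Dz : D' (f z) by exists z.
  have [Bg fg] := gP _ Dz; exists (f z) => //.
  by apply: f_inj; rewrite ?in_setE.
(* D' indexes the basis, D the basis vectors outside the kernel of U. *)
pose D := [set n | D' n /\ U (g n) != 0].
have DD' : D `<=` D' by move=> n [].
pose s n := rnorm (U (g n)).
have s0 n : D n -> 0 < s n by move=> [_ Un]; exact: rnorm_gt0.
exists D, s, (fun n => (s n)^-1%:C *: U (g n)), g; split => //.
- move=> m n Dm Dn; rewrite dotZl dotZr conj_real UV.
  have [l Vl] := Beig _ (gP _ (DD' _ Dm)).1.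
  have [<-|mn] := eqVneq.
    rewrite -UV dotxx -/(s m) -!rmorphM /= mulrA -expr2 exprVn mulVf //.
    by rewrite expf_eq0 /= gt_eqF // s0.
  by rewrite Vl dotZl go ?(negbTE mn) ?mulr0 //; exact: DD'.
- by move=> m n /DD' Dm /DD' Dn; exact: go.
- move=> h.
  apply: (@eq_cvg_seq R H (fun k => U (fourier_sum D' g k h))); last first.
    exact: (@cvg_bounded_op R H U K _ _ UK (fourier_cvg go gT)).
  move=> k.
  rewrite /fourier_sum linear_sum [LHS]big_mkcond [RHS]big_mkcond /=.
  apply: eq_bigr => n _; have [nD|nD] := boolP (n \in D).
    rewrite (_ : n \in D' = true); last by apply/mem_set/DD'/set_mem.
    rewrite linearZ /rank_one /= !scalerA; congr (_ *: _).
    rewrite mulrAC -rmorphM mulfV ?mul1r //.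
    by rewrite gt_eqF // s0 //; exact: set_mem.
  case: ifP => // nD'; rewrite linearZ /=.
  have /eqP -> : U (g n) == 0; last by rewrite scaler0.
  by apply: contraNT nD => Un; apply/mem_set; split => //; exact: set_mem.
Qed.

End SchmidtFromDiagonal.

(** * Singular vectors of PQ and eigenvectors of its commutator *)

Section TwoProjections.
Variables (R : realType) (H : hilbertType R) (P Q : {linear H -> H}).
Hypotheses (HP : orthogonal_projection P) (HQ : orthogonal_projection Q).
Implicit Types (v w x y : H).

Local Notation K := (commutator_op P Q).

Lemma orthogonal_projection_rnorm_le (F : {linear H -> H}) x :
  orthogonal_projection F -> rnorm (F x) <= rnorm x.
Proof.
move=> [_ FF Fs].
have [->|Fx0] := eqVneq (F x) 0; first by rewrite rnorm0 rnorm_ge0.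
rewrite -(ler_pM2l (rnorm_gt0 Fx0)) -expr2 rnorm_sqr Fs FF [leRHS]mulrC.
exact: le_trans (Re_le_normc _) (cauchy_schwarz _ _).
Qed.

Lemma dot_ext x y : (forall z, '<x, z> = '<y, z>) -> x = y.
Proof.
move=> xy; apply/eqP; rewrite -subr_eq0; apply/eqP; apply: dotxx_eq0.
by rewrite dotBl xy subrr.
Qed.

Lemma commutator_linear : linear K.
Proof.
by move=> a x y; rewrite /commutator_op !linearP /= addrACA -scalerDr.
Qed.

Lemma commutator_skew x y : '<K x, y> = -1 * '<x, K y>.
Proof.
have [[_ _ Ps] [_ _ Qs]] := (HP, HQ).
by rewrite /commutator_op dotBl dotBr mulN1r opprB Ps Qs Qs Ps.
Qed.

Section Schmidt.
Variables (D : set nat) (s : nat -> R) (f g : nat -> H).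
Hypothesis PQsd : schmidt_decomposition (P \o Q) D s f g.

Let s_gt0 n : D n -> 0 < s n. Proof. by have [+ _ _ _] := PQsd; apply. Qed.
Let fo : orthonormal_system D f. Proof. by have [] := PQsd. Qed.
Let go : orthonormal_system D g. Proof. by have [] := PQsd. Qed.
Let part h k := \sum_(0 <= n < k | n \in D) (s n)%:C *: rank_one (f n) (g n) h.
Let part_cvg h : part h @ \oo --> P (Q h). Proof. by have [_ _ _] := PQsd; apply. Qed.
Let s_neq0 n : D n -> (s n)%:C != 0.
Proof. by move=> /s_gt0 s0; rewrite eq_complex /= eqxx andbT gt_eqF. Qed.

Lemma schmidt_right n : D n -> P (Q (g n)) = (s n)%:C *: f n.
Proof.
move=> Dn; apply: (@rnorm_cvg_unique _ _ (part (g n))); first exact: part_cvg.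
apply/cvg_rnormP => e e0; exists n.+1 => k nk.
rewrite /part big_mkord (bigD1 (Ordinal nk)) /= ?in_setE // big1.
  by rewrite addr0 /rank_one go // eqxx scale1r subrr rnorm0.
move=> i /andP[/set_mem Di ni]; rewrite /rank_one go // eq_sym.
by rewrite -val_eqE /= in ni; rewrite (negbTE ni) scale0r scaler0.
Qed.

Lemma dot_schmidt h n : D n -> '<P (Q h), f n> = (s n)%:C * '<h, g n>.
Proof.
move=> Dn; apply: (@cvg_dot_const R H (part h)); first exact: part_cvg.
 
exists n.+1 => k nk; rewrite /part big_mkord dot_suml.
rewrite (bigD1 (Ordinal nk)) /= ?in_setE // big1.
  by rewrite addr0 /rank_one !dotZl fo // eqxx mulr1.
move=> i /andP[/set_mem Di ni]; rewrite /rank_one !dotZl fo //.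
by rewrite -val_eqE /= in ni; rewrite (negbTE ni) !mulr0.
Qed.

Lemma schmidt_left n : D n -> Q (P (f n)) = (s n)%:C *: g n.
Proof.
have [[_ _ Ps] [_ _ Qs]] := (HP, HQ).
move=> Dn; apply: dot_ext => h.
by rewrite Qs Ps dotC dot_schmidt // rmorphM /= conj_real dotZl -dotC.
Qed.

Lemma schmidt_right0 w : (forall n, D n -> '<w, g n> = 0) -> P (Q w) = 0.
Proof.
move=> wg; apply: (@rnorm_cvg_unique _ _ (part w)); first exact: part_cvg.
 apply/cvg_rnormP => e e0.
exists 0%N => k _; rewrite /part big1 ?subrr ?rnorm0 // => n /set_mem Dn.
by rewrite /rank_one wg // scale0r scaler0.
Qed.

Lemma schmidt_left0 w : (forall n, D n -> '<w, f n> = 0) -> Q (P w) = 0.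
Proof.
have [[_ _ Ps] [_ _ Qs]] := (HP, HQ).
move=> wf; apply: dot_ext => h; rewrite dot0l Qs Ps; apply: dotC0.
apply: (@cvg_dot_const R H (part h)); first exact: part_cvg;
  exists 0%N => k _.
rewrite /part dot_suml big1 // => n /set_mem Dn.
by rewrite /rank_one !dotZl (dotC0 (wf n Dn)) !mulr0.
Qed.

Lemma schmidt_left_fixed n : D n -> P (f n) = f n.
Proof.
have [_ PP _] := HP.
move=> Dn; apply: (scalerI (s_neq0 Dn)).
by rewrite -linearZ -schmidt_right // PP.
Qed.

Lemma schmidt_right_fixed n : D n -> Q (g n) = g n.
Proof.
have [_ QQ _] := HQ.
move=> Dn; apply: (scalerI (s_neq0 Dn)).
by rewrite -linearZ -schmidt_left // QQ.
Qed.

Lemma dot_schmidt_vectors n : D n -> '<f n, g n> = (s n)%:C.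
Proof.
have [_ _ Ps] := HP; move=> Dn.
rewrite -{1}(schmidt_left_fixed Dn) Ps -(schmidt_right_fixed Dn) schmidt_right //.
by rewrite dotZr conj_real fo // eqxx mulr1.
Qed.

Let rnorm_f n : D n -> rnorm (f n) ^+ 2 = 1.
Proof. by move=> Dn; rewrite rnorm_sqr fo // eqxx. Qed.
Let rnorm_g n : D n -> rnorm (g n) ^+ 2 = 1.
Proof. by move=> Dn; rewrite rnorm_sqr go // eqxx. Qed.

Lemma singular_value_le1 n : D n -> s n <= 1.
Proof.
move=> Dn; have := sqr_ge0 (rnorm (f n - g n)).
by rewrite rnorm_sqrB rnorm_f // rnorm_g // dot_schmidt_vectors //=; lra.
Qed.

Lemma schmidt_vectors_eq n : D n -> s n = 1 -> f n = g n.
Proof.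
move=> Dn s1; apply/eqP; rewrite -subr_eq0; apply/eqP; apply: rnorm_eq0.
apply/eqP; rewrite -sqrf_eq0 rnorm_sqrB rnorm_f // rnorm_g //.
by rewrite dot_schmidt_vectors // s1 /=; apply/eqP; ring.
Qed.

Lemma commutator_left n : D n ->
  K (f n) = ((s n) ^+ 2)%:C *: f n - (s n)%:C *: g n.
Proof.
move=> Dn; rewrite /commutator_op schmidt_left //; congr (_ - _).
rewrite -{1}(schmidt_left_fixed Dn) schmidt_left // linearZ /=.
by rewrite -(schmidt_right_fixed Dn) schmidt_right // scalerA -rmorphM.
Qed.

Lemma commutator_right n : D n ->
  K (g n) = (s n)%:C *: f n - ((s n) ^+ 2)%:C *: g n.
Proof.
move=> Dn; rewrite /commutator_op schmidt_right //; congr (_ - _).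
rewrite -{1}(schmidt_right_fixed Dn) schmidt_right // linearZ /=.
by rewrite -(schmidt_left_fixed Dn) schmidt_left // scalerA -rmorphM.
Qed.

(** If s_n < 1, then for each of the two eigenvalues m of K on the plane of f_n
    and g_n this is an eigenvector; if s_n = 1, then m = 0 and it vanishes. *)
Let vec n (m : R[i]) := (s n)%:C *: f n + (m - (s n ^+ 2)%:C) *: g n.

(** The commutator maps the plane of f_n and g_n into itself, with trace zero
    and determinant s_n^2 - s_n^4. *)
Lemma commutator_plane n (m : R[i]) : D n ->
  m ^+ 2 = ((s n) ^+ 4 - (s n) ^+ 2)%:C -> K (vec n m) = m *: vec n m.
Proof.
move=> Dn m2; rewrite /vec commutator_linear linear_funZ; last exact: commutator_linear.
rewrite commutator_left // commutator_right // !scalerBr scalerDr !scalerA addrACA.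
rewrite -opprD -!scalerDl -scaleNr; congr (_ *: _ + _ *: _).
  rewrite rmorphXn; ring.
rewrite [RHS]mulrBr -[m * m]expr2 m2 rmorphB !rmorphXn; ring.
Qed.

Let mu n : R[i] := 'i * (s n * Num.sqrt (1 - s n ^+ 2))%:C.

Lemma singular_eigenvalue_sqr n : D n -> mu n ^+ 2 = ((s n) ^+ 4 - (s n) ^+ 2)%:C.
Proof.
move=> Dn; rewrite /mu exprMn sqr_i -rmorphXn /= exprMn sqr_sqrtr.
  by rewrite mulN1r -rmorphN /=; congr (_ %:C); ring.
have := singular_value_le1 Dn; have := s_gt0 Dn; nra.
Qed.

Let mu1 n : s n = 1 -> mu n = 0.
Proof. by rewrite /mu => ->; rewrite expr1n subrr sqrtr0 !mulr0. Qed.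

Lemma commutator_right_eq1 n : D n -> s n = 1 -> K (g n) = 0.
Proof.
by move=> Dn s1; rewrite commutator_right // schmidt_vectors_eq // s1 expr1n subrr.
Qed.

Let g_neq0 n : D n -> g n != 0.
Proof.
move=> Dn; apply/eqP => g0; have := rnorm_g Dn.
by rewrite g0 rnorm0 expr0n => /esym /eqP; rewrite oner_eq0.
Qed.

Lemma eigenval_of_singular n (m : R[i]) : D n -> m = mu n \/ m = - mu n -> eigenval K m.
Proof.
move=> Dn mE.
(* If s_n = 1, then f_n = g_n and the plane degenerates to a line in the kernel. *)
have [s1|s1] := eqVneq (s n) 1.
  exists (g n); first exact: g_neq0.
  by rewrite commutator_right_eq1 //; case: mE => ->; rewrite mu1 // ?oppr0 scale0r.
have m2 : m ^+ 2 = ((s n) ^+ 4 - (s n) ^+ 2)%:C.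
  by rewrite -singular_eigenvalue_sqr //; case: mE => ->; rewrite ?sqrrN.
exists (vec n m); last exact: commutator_plane.
apply/eqP => v0; have : '<vec n m, f n> = 0 by rewrite v0 dot0l.
rewrite /vec dotDl !dotZl fo // eqxx mulr1 (dotC (g n)) dot_schmidt_vectors // conj_real.
have -> : (s n)%:C + (m - (s n ^+ 2)%:C) * (s n)%:C =
  (s n)%:C * (m + (1 - s n ^+ 2)%:C) by rewrite rmorphB rmorph1; ring.
move=> /eqP; rewrite mulf_eq0 (negbTE (s_neq0 Dn)) /= addr_eq0 => /eqP mE'.
move: m2; rewrite mE' sqrrN -rmorphXn => /complexI.
have := s_gt0 Dn; have := singular_value_le1 Dn; move: s1; set t := s n.
rewrite neq_lt => /orP[t1|t1]; nra.
Qed.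

(** K^2 commutes with P and satisfies P K^2 = (B^2 - B) P for B = PQP, and f_n is an
    eigenvector of B for s_n^2.  If P v were orthogonal to every f_n, then B, hence
    K^2, would kill it. *)
Lemma singular_of_eigenval (l : R[i]) : eigenval K l ->
  l = 0 \/ exists2 n, D n & l = mu n \/ l = - mu n.
Proof.
have [[_ PP Ps] [_ QQ Qs]] := (HP, HQ).
move=> [v v0 Kv]; have [->|l0] := eqVneq l 0; [by left|right].
pose x := P v.
have x2 : P (Q (P (Q x))) - P (Q x) = l ^+ 2 *: x.
  have -> : l ^+ 2 *: x = P (K (K v)).
    by rewrite Kv linear_funZ ?Kv; [rewrite scalerA linearZ|exact: commutator_linear].
  rewrite /commutator_op /x !linearB /= !(PP, QQ).
  by rewrite opprK [RHS]addrC addrACA addNr add0r.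
have x_neq0 : x != 0.
  apply/eqP => x0; move: Kv; rewrite /commutator_op -/x x0 linear0 subr0 => PQv.
  have /eqP : l *: v = 0 by rewrite -PQv -PP PQv linearZ /= -/x x0 scaler0.
  by rewrite scaler_eq0 (negbTE l0) (negbTE v0).
have [[n Dn xf]|xf] := pselect (exists2 n, D n & '<x, f n> != 0).
  exists n => //; have sq : l ^+ 2 = mu n ^+ 2.
    apply: (mulIf xf); rewrite -dotZl -x2 singular_eigenvalue_sqr // dotBl.
    have dot_g y : P y = y -> '<y, g n> = (s n)%:C * '<y, f n>.
      move=> Py; rewrite -Py Ps -(schmidt_right_fixed Dn) schmidt_right //.
      by rewrite dotZr conj_real Py.
    have Px : P x = x by rewrite /x PP.
    rewrite dot_schmidt // dot_g ?PP // !dot_schmidt // (dot_g x) //.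
    by rewrite rmorphB !rmorphXn /=; ring.
  by apply/pred2P; rewrite -eqf_sqr sq.
have Qx0 : Q (P x) = 0.
  by apply: schmidt_left0 => n Dn; apply: contrapT => /eqP xfn; apply: xf; exists n.
have Px : P x = x by rewrite /x PP.
move: x2; rewrite Px in Qx0; rewrite Qx0 !linear0 ?addr0 => /esym/eqP.
by rewrite scaler_eq0 expf_eq0 /= (negbTE l0) (negbTE x_neq0).
Qed.

(** The planes of f_n and g_n are spanned by eigenvectors, and a vector
    orthogonal to all of them is in the kernel of K. *)
Lemma commutator_eigenvectors_total : total (eigenvectors K).
Proof.
move=> w wK.
suff wfg n : D n -> '<w, f n> = 0 /\ '<w, g n> = 0.
  apply: dotxx_eq0; apply: wK; exists 0; rewrite scale0r /commutator_op.
  by rewrite schmidt_right0 ?schmidt_left0 ?subrr // => n /wfg [].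
move=> Dn; have [s1|s1] := eqVneq (s n) 1.
  have wg : '<w, g n> = 0.
    by apply: wK; exists 0; rewrite commutator_right_eq1 // scale0r.
  by rewrite schmidt_vectors_eq.
have vK m : m = mu n \/ m = - mu n -> '<w, vec n m> = 0.
  move=> mE; apply: wK; exists m; apply: commutator_plane => //.
  by rewrite -singular_eigenvalue_sqr //; case: mE => ->; rewrite ?sqrrN.
have mu0 : mu n != 0.
  rewrite -sqrf_eq0 singular_eigenvalue_sqr //; apply/eqP => /complexI.
  have t0 := s_gt0 Dn; have t1 : s n < 1 by rewrite lt_neqAle s1 singular_value_le1.
  have : 0 < s n ^+ 2 * (1 - s n) * (1 + s n).
    by rewrite !mulr_gt0 ?exprn_gt0 ?subr_gt0 // addr_gt0.
  have -> : s n ^+ 2 * (1 - s n) * (1 + s n) = - (s n ^+ 4 - s n ^+ 2) by ring.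
  by move=> + s42; rewrite s42 oppr0 ltxx.
have wg : '<w, g n> = 0.
  have : '<w, vec n (mu n) - vec n (- mu n)> = 0.
    by rewrite dotBr !vK ?subrr; [|right|left].
  have -> : vec n (mu n) - vec n (- mu n) = (mu n *+ 2) *: g n.
    by rewrite /vec opprD addrACA subrr add0r -scalerBl; congr (_ *: _); ring.
  move=> /eqP; rewrite dotZr mulf_eq0 conjC_eq0 mulrn_eq0 (negbTE mu0) /=.
  by move=> /eqP.
split => //; have := vK _ (or_introl erefl).
rewrite /vec dotDr !dotZr wg mulr0 addr0 conj_real => /eqP.
by rewrite mulf_eq0 (negbTE (s_neq0 Dn)) => /eqP.
Qed.

End Schmidt.

End TwoProjections.

(** * The Halmos decomposition *)

Section Halmos.
Variables (R : realType) (H L : hilbertType R) (P Q : {linear H -> H}).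
Variables (W : {linear (L * L)%type -> H}) (X : {linear L -> L}).
Hypotheses (HP : orthogonal_projection P) (HQ : orthogonal_projection Q).
Hypothesis HX : halmos_decomposition P Q W X.
Implicit Types (a b v : L) (w x y z : H).

Local Notation C := (op_cos X).
Local Notation S := (op_sin X).
Local Notation K := (commutator_op P Q).

Lemma halmos_form_bounds v :
  0 * rnorm v ^+ 2 <= complex.Re '<X v, v> <= pi / 2 * rnorm v ^+ 2.
Proof.
have := halmos_ge0 HX v; have := halmos_le_pi2 HX v.
rewrite !lecE /= dotxx mul0r Re_realM => /andP[_ ->] /andP[_ ->].
by [].
Qed.

Lemma setT_subspace : subspace [set: L]. Proof. by []. Qed.

Lemma halmos_rnorm_le v : rnorm (X v) <= pi / 2 * rnorm v.
Proof.
have K0 : 0 < pi / 2 :> R := lt_le_trans ltr01 (@pihalf_ge1 R).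
have := @positive_form_bound R L X setT (pi / 2) v (linearP X)
  (halmos_selfadjoint HX) setT_subspace (fun _ _ => I) K0.
move=> /(_ _ I) bnd.
rewrite -(ler_pXn2r (n := 2)) ?nnegrE ?mulr_ge0 ?rnorm_ge0 ?(ltW K0) ?pi_ge0 //.
apply: (le_trans (bnd _)) => [w _|].
  by have := halmos_form_bounds w; rewrite mul0r.
have /andP[_ fle] := halmos_form_bounds v.
move: fle K0; set k := pi / 2 => fle K0.
by rewrite exprMn [k ^+ 2]expr2 -[leRHS]mulrA ler_pM2l.
Qed.

Lemma op_sin0 : S 0 = 0.
Proof.
have i0 j : iter j X 0 = 0 by elim: j => //= j ->; rewrite linear0.
rewrite /op_sin (_ : series _ = fun=> 0); first exact: lim_cst.
by apply/funext => n; rewrite /series /= big1 // => k _; rewrite i0 linear0 scaler0.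
Qed.

Let XK := halmos_rnorm_le.

Lemma op_cos0 : C 0 = 0.
Proof. exact: linear_fun0 (op_cos_linear (@pihalf_ge1 R) XK). Qed.

Lemma halmos_inj a b a' b' : W (a, b) = W (a', b') -> a = a' /\ b = b'.
Proof.
move=> /eqP; rewrite -subr_eq0 -linearB => /eqP W0.
have := halmos_isometry HX ((a, b) - (a', b')) ((a, b) - (a', b')).
rewrite W0 dot0l /= !dotxx -rmorphD => /complexI /esym /eqP.
rewrite paddr_eq0 ?sqr_ge0 // !sqrf_eq0 => /andP[/eqP /rnorm_eq0 + /eqP /rnorm_eq0].
by move=> /eqP + /eqP; rewrite !subr_eq0 => /eqP -> /eqP ->.
Qed.

(** The entries of the first column of Q.  Their linearity, the selfadjointness of
    the first one and the relation between them are all read off from Q. *)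
Definition cosX2 a := C (C a).
Definition cosX_sinX a := C (S a).

Lemma halmos_Q_left a : Q (W (a, 0)) = W (cosX2 a, cosX_sinX a).
Proof. by rewrite (halmos_Q HX) /= op_sin0 op_cos0 !addr0 op_sin0 addr0. Qed.

Lemma halmos_PQ a b : P (Q (W (a, b))) = W (cosX2 a + cosX_sinX b, 0).
Proof. by rewrite (halmos_Q HX) (halmos_P HX). Qed.

Lemma halmos_commutator a b : K (W (a, b)) = W (cosX_sinX b, - cosX_sinX a).
Proof.
rewrite /commutator_op halmos_PQ (halmos_P HX) halmos_Q_left -linearB.
congr (W _); apply: injective_projections => /=; last by rewrite sub0r.
by rewrite addrC addKr.
Qed.

Let Qcolumn_linear c a b :
  cosX2 (c *: a + b) = c *: cosX2 a + cosX2 b /\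
  cosX_sinX (c *: a + b) = c *: cosX_sinX a + cosX_sinX b.
Proof.
apply: halmos_inj; rewrite -halmos_Q_left.
have -> : (c *: a + b, 0) = c *: (a, 0) + (b, 0) :> L * L.
  by apply: injective_projections => //=; rewrite scaler0 addr0.
by rewrite !linearP /= !halmos_Q_left -linearP.
Qed.

Lemma cosX2_linear : linear cosX2.
Proof. by move=> c a b; have [] := Qcolumn_linear c a b. Qed.

Lemma cosX_sinX_linear : linear cosX_sinX.
Proof. by move=> c a b; have [] := Qcolumn_linear c a b. Qed.

Lemma cosX2_selfadjoint : selfadjoint cosX2.
Proof.
move=> a b; have [_ _ Qs] := HQ.
have := Qs (W (a, 0)) (W (b, 0)).
by rewrite !halmos_Q_left !(halmos_isometry HX) /= dot0l dot0r !addr0.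
Qed.

(** The upper entry of the first column of Q^2 = Q. *)
Lemma cosX_sinX_sqr a : cosX_sinX (cosX_sinX a) = cosX2 a - cosX2 (cosX2 a).
Proof.
have [_ QQ _] := HQ; have := QQ (W (a, 0)).
rewrite halmos_Q_left (halmos_Q HX) /= => /halmos_inj [+ _].
rewrite -/(cosX2 _) -/(cosX_sinX _) => e.
by apply/eqP; rewrite eq_sym subr_eq addrC e.
Qed.

Lemma cosX2_comm v : cosX2 (X v) = X (cosX2 v).
Proof. by rewrite /cosX2 !(op_cos_comm (@pihalf_ge1 R) XK). Qed.

Let itvK (M : R) : 0 <= M <= pi / 2 -> `|M| <= pi / 2.
Proof. by move=> /andP[M0 M1]; rewrite ger0_norm. Qed.

Lemma cos_sqr_inj (M N : R) : 0 <= M <= pi / 2 -> 0 <= N <= pi / 2 ->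
  cos M ^+ 2 = cos N ^+ 2 -> M = N.
Proof.
move=> /andP[M0 M1] /andP[N0 N1] /eqP; have pi0 := @pi_gt0 R.
have cos_nonneg (t : R) : 0 <= t -> t <= pi / 2 -> 0 <= cos t.
  by move=> t0 t1; apply: cos_ge0_pihalf; rewrite t1 andbT; lra.
rewrite eqrXn2 ?cos_nonneg // => /eqP; apply: cos_inj; rewrite in_itv /=; lra.
Qed.

(** The eigenspace of cos^2 X is invariant under X, and t |-> cos^2 t is injective
    on the interval [0, pi / 2] that contains the values of the form of X. *)
Lemma eigenvector_of_cosX2 (l : R[i]) v : cosX2 v = l *: v -> eigenvectors X v.
Proof.
move=> vl; pose E : set L := [set v | cosX2 v = l *: v].
have sE : subspace E.
  split=> [|c x y]; rewrite /E /=; first by rewrite (linear_fun0 cosX2_linear) scaler0.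
  by move=> xl yl; rewrite cosX2_linear xl yl scalerDr !scalerA mulrC.
have XE (w : L) : E w -> E (X w) by rewrite /E /= => wl; rewrite cosX2_comm wl linearZ.
have [B B0 approx] := op_cos_sqr_approx (@pihalf_ge1 R) XK.
have [||//|x xP] := @scalar_on_subspace R L X E 0 (pi / 2) (fun M => cos M ^+ 2)
  cosX2 B l (linearP X) (halmos_selfadjoint HX) sE XE (fun (w : L) _ => halmos_form_bounds w) B0.
- by move=> M w /itvK; exact: approx.
- exact: cos_sqr_inj.
by exists x%:C; exact: xP.
Qed.

(** The eigenvalue is real and between 0 and pi / 2, and an exact eigenvector is
    an approximate one with zero error. *)
Lemma eigenvector_cosX2 v : eigenvectors X v -> exists l : R[i], cosX2 v = l *: v.
Proof.
move=> [x Xv]; have [->|v0] := eqVneq v 0.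
  by exists 0; rewrite (linear_fun0 cosX2_linear) scaler0.
have n2 : 0 < rnorm v ^+ 2 by rewrite exprn_gt0 // rnorm_gt0.
have xr : x = (complex.Re x)%:C.
  have := halmos_selfadjoint HX v v; rewrite Xv dotZl dotZr dotxx => /mulIf xx.
  have {}xx : x = Num.conj x by apply: xx; rewrite eq_complex /= eqxx andbT gt_eqF.
  by rewrite RRe_real // CrealE -xx.
have := halmos_form_bounds v; rewrite Xv dotZl dotxx xr Re_realM /=.
rewrite !ler_pM2r // => Mb.
have [B B0 approx] := op_cos_sqr_approx (@pihalf_ge1 R) XK.
have := approx _ v (itvK Mb); rewrite -xr Xv subrr rnorm0 mulr0 => /rnorm_le0 /eqP.
by rewrite subr_eq0 => /eqP ?; exists (cos (complex.Re x) ^+ 2)%:C.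
Qed.

(** On v the operator cos^2 X is a root of the polynomial t^2 - t + nu.  If its
    roots l1 and l2 are distinct, then v splits along the two eigenspaces; if 1/2 is a
    double root, then v is an eigenvector because cos^2 X is selfadjoint. *)
Lemma cosX2_split (nu : R[i]) v : cosX2 v - cosX2 (cosX2 v) = nu *: v ->
  exists v1 v2, [/\ v = v1 + v2, eigenvectors X v1 & eigenvectors X v2].
Proof.
move=> vnu; pose s := sqrtc (1 - 4%:R * nu).
have s2 : s ^+ 2 = 1 - 4%:R * nu by exact: sqr_sqrtc.
have c2 : cosX2 (cosX2 v) = cosX2 v - nu *: v.
  by rewrite -vnu opprB addrC subrK.
have c2l (l : R[i]) : cosX2 (cosX2 v - l *: v) = (1 - l) *: cosX2 v - nu *: v.
  rewrite addrC -scaleNr cosX2_linear c2 scalerBl scale1r scaleNr addrA; congr (_ - _).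
  by rewrite addrC.
have [s0|s0] := eqVneq s 0.
  exists v, 0; split; [by rewrite addr0| |by exists 0; rewrite linear0 scaler0].
  apply: (@eigenvector_of_cosX2 2^-1).
  apply/eqP; rewrite -subr_eq0; apply/eqP; apply: dotxx_eq0.
  set u := cosX2 v - _.
  have nu4 : nu = 2^-1 * 2^-1.
    have four_nu : 4%:R * nu = 1.
      by apply/eqP; rewrite eq_sym -subr_eq0 -s2 s0 expr0n.
    by apply: (@mulfI _ 4%:R); rewrite ?pnatr_eq0 // four_nu; field.
  have cu : cosX2 u = 2^-1 *: u.
    rewrite /u c2l scalerBr scalerA -nu4; congr (_ *: _ - _).
    by field.
  have half_real : Num.conj (2^-1 : R[i]) = 2^-1 by rewrite fmorphV rmorph_nat.
  by rewrite {1}/u dotBl cosX2_selfadjoint cu dotZr dotZl half_real subrr.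
pose l1 := (1 + s) / 2; pose l2 := (1 - s) / 2.
have l1l2 : l1 * l2 = nu.
  have -> : l1 * l2 = (1 - s ^+ 2) / 4%:R by rewrite /l1 /l2; field.
  by rewrite s2; field.
exists (s^-1 *: (cosX2 v - l2 *: v)), (- s^-1 *: (cosX2 v - l1 *: v)); split.
- rewrite scaleNr -scalerBr opprB [X in _ *: X]addrC subrKA -scalerBl scalerA.
  have -> : s^-1 * (l1 - l2) = 1 by rewrite /l1 /l2; field.
  by rewrite scale1r.
- apply: eigenvectors_line; first exact: linearP.
  apply: (@eigenvector_of_cosX2 l1); rewrite c2l scalerBr scalerA l1l2.
  by congr (_ *: _ - _); rewrite /l1 /l2; field.
- apply: eigenvectors_line; first exact: linearP.
  apply: (@eigenvector_of_cosX2 l2); rewrite c2l scalerBr scalerA [l2 * _]mulrC l1l2.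
  by congr (_ *: _ - _); rewrite /l1 /l2; field.
Qed.

(** The generic component W (a, b) of an eigenvector of the commutator is again
    an eigenvector, and a is then a sum of eigenvectors of X.  So if v is orthogonal
    to the eigenvectors of X, then W (v, 0) is orthogonal to a basis. *)
Lemma diagonalizable_X : diagonalizable_op K -> diagonalizable_op X.
Proof.
move=> [B [[Bo BT] Beig]].
apply: (@diagonalizable_of_total R L X 1); first exact: linearP.
  by move=> x y; rewrite mul1r (halmos_selfadjoint HX).
move=> v vX.
suff /halmos_inj [] : W (v, 0) = W (0, 0) by [].
rewrite -[RHS](_ : 0 = _); last by rewrite -[(0, 0)]/(0 : L * L) linear0.
apply: (dense_total BT) => e Be; have [l Ke] := Beig e Be.
have sW : subspace (range W).
  by rewrite (halmos_range HX); exact: ortho_compl_subspace.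
have [|y [[a b] _ yW] ez] := projection e sW.
  by rewrite (halmos_range HX); exact: ortho_compl_closed.
set z := e - y in ez.
have dotWz u : '<W u, z> = 0 by apply: dotC0; apply: ez; exists u.
have e_yz : e = y + z by rewrite /z addrC subrK.
have Kl := commutator_linear P Q.
have KW u : range W (K (W u)).
  by case: u => a' b'; rewrite halmos_commutator; exists (cosX_sinX b', - cosX_sinX a').
have Kz u : '<W u, K z> = 0.
  have [u' _ Ku] := KW u.
  have := commutator_skew HP HQ (W u) z; rewrite -Ku dotWz mulN1r => /eqP.
  by rewrite eq_sym oppr_eq0 => /eqP.
have Ky : K y = l *: y.
  (* The left side is in the range of W, the right side is orthogonal to it. *)
  have eqyz : K y - l *: y = l *: z - K z.
    have Kyz : K y + K z = l *: y + l *: z.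
      by rewrite -scalerDr -e_yz -Ke e_yz -[y in RHS]scale1r Kl scale1r.
    by apply/eqP; rewrite subr_eq -(addrK (K z) (K y)) Kyz -addrA addrC.
  apply/eqP; rewrite -subr_eq0; apply/eqP; apply: dotxx_eq0.
  have [u _ uE] : range W (K y - l *: y).
    by rewrite -yW; apply: (subspaceB sW) (KW _) (subspaceZ _ sW _); exists (a, b).
  by rewrite {2}eqyz -uE dotBr dotZr dotWz Kz mulr0 subrr.
move: Ky; rewrite -yW halmos_commutator -linearZ => /halmos_inj /= [Db Da].
have DE (c : L) (m : R[i]) : cosX_sinX (m *: c) = m *: cosX_sinX c.
  exact: linear_funZ cosX_sinX_linear.
have /cosX2_split [a1 [a2 [aE a1X a2X]]] : cosX2 a - cosX2 (cosX2 a) = (- l ^+ 2) *: a.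
  rewrite -cosX_sinX_sqr -[cosX_sinX a]opprK Da -scaleNr DE Db scalerA.
  by rewrite mulNr expr2.
by rewrite e_yz dotDr dotWz addr0 -yW (halmos_isometry HX) /= dot0l addr0 aE dotDr
  vX // vX // addr0.
Qed.

Local Notation QPQ := (fun x => Q (P (Q x))).

(** A vector w orthogonal to the eigenvectors of QPQ is orthogonal to the kernel
    of Q and lies in the generic part, so w = W (a, b) and Q w = w.  Since Q W (e, 0)
    is an eigenvector of QPQ for each eigenvector e of X, the vector a is orthogonal
    to e; hence a = 0, and w is in the null space of P and in the range of Q, to which the
    generic part is orthogonal. *)
Lemma QPQ_eigenvectors_total : diagonalizable_op X -> total (eigenvectors QPQ).
Proof.
have [[_ PP Ps] [_ QQ Qs]] := (HP, HQ).
move=> [B [[Bo BT] Beig]] w wT.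
have kerT x : Q x = 0 -> eigenvectors QPQ x.
  by move=> Qx; exists 0; rewrite Qx !linear0 scale0r.
have Qw : Q w = w.
  apply/esym/eqP; rewrite -subr_eq0; apply/eqP; apply: dotxx_eq0.
  have kw : Q (w - Q w) = 0 by rewrite linearB /= QQ subrr.
  rewrite dotBl wT; last exact: kerT.
  by rewrite Qs kw dot0r subrr.
have : generic_part P Q w.
  move=> _ [x11 [x00 [x10 [x01 [[[p11 _ P11] [q11 _ Q11]] [_ Q00] [_ Q10] [P01 [q01 _ Q01]] ->]]]]].
  rewrite !dotDr !wT ?addr0 //; try exact: kerT.
  (* The terms of the null space of Q are gone; H01 and H11 remain. *)
  - exists 0; have -> : Q x01 = x01 by rewrite -Q01 QQ.
    by rewrite P01 linear0 scale0r.
  - exists 1; have Qx : Q x11 = x11 by rewrite -Q11 QQ.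
    have Px : P x11 = x11 by rewrite -P11 PP.
    by rewrite Qx Px Qx scale1r.
move=> wG; have : generic_part P Q w by [].
rewrite -(halmos_range HX) => -[[a b] _ wW].
have a0 : a = 0.
  apply: (dense_total BT) => v Bv; have [l vl] := eigenvector_cosX2 (Beig v Bv).
  have := halmos_isometry HX (a, b) (v, 0); rewrite /= dot0r addr0 => <-.
  rewrite wW -Qw Qs; apply: wT; exists l.
  rewrite QQ [in LHS]halmos_Q_left (halmos_P HX) -!linearZ; congr (Q (W _)).
  by rewrite vl; apply: injective_projections => //=; rewrite scaler0.
have Pw : P w = 0.
  by rewrite -wW a0 (halmos_P HX) -[(0, 0)]/(0 : L * L) linear0.
apply: dotxx_eq0; apply: wG; exists 0, 0, 0, w.
split; rewrite ?add0r //.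
- by split; exists 0; rewrite ?linear0.
- by split; rewrite /null_space /= linear0.
- by split; [exists 0; rewrite ?linear0|rewrite /null_space /= linear0].
- by split => //; exists w.
Qed.

Lemma schmidt_decomposable_PQ : separable_space H -> diagonalizable_op X ->
  schmidt_decomposable (P \o Q).
Proof.
have [[_ PP Ps] [_ QQ Qs]] := (HP, HQ).
move=> Hsep Xd; apply: (@schmidt_of_diagonal R H (P \o Q) QPQ 1) => //.
- move=> x /=; rewrite mul1r.
  exact: le_trans (orthogonal_projection_rnorm_le _ HP) (orthogonal_projection_rnorm_le _ HQ).
- by move=> x y /=; rewrite Ps PP [RHS]Qs [RHS]Ps.
apply: (@diagonalizable_of_total R H QPQ 1).
- by move=> c x y; rewrite !linearP.
- by move=> x y; rewrite mul1r Qs Ps Qs.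
exact: QPQ_eigenvectors_total.
Qed.

End Halmos.

Theorem theorem4p1 (R : realType) (H : hilbertType R)
    (Hsep : separable_space H) (P Q : {linear H -> H})
    (HP : orthogonal_projection P) (HQ : orthogonal_projection Q)
    (L : hilbertType R) (W : {linear (L * L)%type -> H}) (X : {linear L -> L})
    (HX : halmos_decomposition P Q W X) :
  [/\ schmidt_decomposable (P \o Q) <-> diagonalizable_op (commutator_op P Q),
      diagonalizable_op (commutator_op P Q) <-> diagonalizable_op X &
      forall (D : set nat) (s : nat -> R) (f g : nat -> H),
        schmidt_decomposition (P \o Q) D s f g ->
        let mu n : R[i] := 'i * (s n * Num.sqrt (1 - s n ^+ 2))%:C in
        (forall n, D n -> eigenval (commutator_op P Q) (mu n) /\
                          eigenval (commutator_op P Q) (- mu n)) /\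
        (forall l : R[i], eigenval (commutator_op P Q) l ->
           l = 0 \/ exists2 n, D n & l = mu n \/ l = - mu n)].
Proof.
have schmidt_diag : schmidt_decomposable (P \o Q) -> diagonalizable_op (commutator_op P Q).
  move=> [D [s [f [g PQsd]]]].
  apply: (@diagonalizable_of_total R H _ (-1)).
  - exact: commutator_linear.
  - exact: commutator_skew.
  exact: (commutator_eigenvectors_total HP HQ PQsd).
have diag_X : diagonalizable_op (commutator_op P Q) -> diagonalizable_op X.
  exact: (diagonalizable_X HP HQ HX).
have X_schmidt : diagonalizable_op X -> schmidt_decomposable (P \o Q).
  exact: (schmidt_decomposable_PQ HP HQ HX Hsep).
split; [by split => // /diag_X| |].
  by split => // /X_schmidt.
move=> D s f g PQsd mu; split=> [n Dn|l].
  by split; apply: (eigenval_of_singular HP HQ PQsd Dn); [left|right].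
exact: (singular_of_eigenval HP HQ PQsd).
Qed.
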